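(* Let $d\ge1$ and $\tau\ge1$. If $\alpha>0$ and $f \in L_1(\mathbb{T}^d)$, then $$\lim_{n\to \infty,\ n\in \mathbb{R}_\tau^d} \sigma^\alpha_{n}f = f \qquad \text{almost everywhere},$$ where $n\in\mathbb{N}^d$ and $n\to\infty$ means $\min(n_1,\ldots,n_d)\to\infty$.
   Context: $\mathbb{T}=[-\pi,\pi]$ is the torus. For $f\in L_1(\mathbb{T}^d)$, $\widehat f(k)=(2\pi)^{-d}\int_{\mathbb{T}^d} f(x)e^{-\imath k\cdot x}\,dx$, $k\in\mathbb{Z}^d$ ($\imath=\sqrt{-1}$). Fix a real parameter $1\le\gamma<\infty$. The rectangular Riesz means, for $n\in\mathbb{N}^d$ with all $n_i\ge1$, are $$\sigma_n^{\alpha}f(x)=\sum_{|k_1|\le n_1}\cdots\sum_{|k_d|\le n_d}\prod_{i=1}^d\Big(1-\Big(\frac{|k_i|}{n_i}\Big)^\gamma\Big)^\alpha\widehat f(k)e^{\imath k\cdot x}.$$ For $\tau\ge1$ the cone is $\mathbb{R}_\tau^d=\{x\in(0,\infty)^d:\tau^{-1}\le x_i/x_j\le\tau,\ i,j=1,\ldots,d\}$. *)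

(* Defs.v *)
From HB Require Import structures.
From mathcomp Require Import all_boot all_order all_algebra.
From mathcomp Require Import complex zify.
From mathcomp Require Import all_classical all_reals all_analysis.
Import Order.TTheory GRing.Theory Num.Theory.
Import numFieldNormedType.Exports.

Set Implicit Arguments.
Unset Strict Implicit.
Unset Printing Implicit Defensive.

Local Open Scope classical_set_scope.
Local Open Scope ring_scope.
Local Open Scope complex_scope.

Definition cons_pair (T : Type) (d : nat) (p : T * d.-tuple T) : d.+1.-tuple T :=
  [tuple of p.1 :: p.2].

Definition uncons_pair (T : Type) (d : nat) (t : d.+1.-tuple T) : T * d.-tuple T :=
  (thead t, [tuple of behead t]).

Lemma cons_pairK (T : Type) (d : nat) : cancel (@cons_pair T d) (@uncons_pair T d).
Proof. by move=> [x t]; rewrite /uncons_pair theadE; congr pair; apply: val_inj. Qed.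

Lemma uncons_pairK (T : Type) (d : nat) : cancel (@uncons_pair T d) (@cons_pair T d).
Proof. by move=> t; rewrite [in RHS](tuple_eta t); apply: val_inj. Qed.

(* The d-dimensional Lebesgue measure, as the d-fold product of the
   one-dimensional one; d.-tuple R carries the product sigma-algebra. *)
Fixpoint lebesgue_tuple (R : realType) (d : nat) : set (d.-tuple R) -> \bar R :=
  match d with
  | 0 => fun A => \d_([tuple] : 0.-tuple R) A
  | d'.+1 => pushforward (@lebesgue_measure R \x @lebesgue_tuple R d')%E
               (@cons_pair R d')
  end.
Arguments lebesgue_tuple : clear implicits.

Section lebesgue_tuple_measure.
Context (R : realType).

Lemma measurable_cons_pair d : measurable_fun setT (@cons_pair R d).
Proof. exact: measurable_cons. Qed.

Lemma measurable_uncons_pair d : measurable_fun setT (@uncons_pair R d).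
Proof.
apply/measurable_fun_pairP; split; last exact: measurable_behead.
exact: measurable_tnth.
Qed.

Lemma lebesgue_tuple_sigma_finite_measure d :
  exists m : {sigma_finite_measure set (d.-tuple R) -> \bar R},
    lebesgue_tuple R d = m.
Proof.
elim: d => [|d [m lm]]; first by eexists (\d_([tuple] : 0.-tuple R)).
pose L : {sigma_finite_measure set (measurableTypeR R) -> \bar R} :=
  @lebesgue_measure R.
pose P : {measure set _ -> \bar R} := (L \x m)%E.
have Poo : sigma_finite setT P.
  have /sigma_finiteP[F [TF ndF Foo]] := sigma_finiteT L.
  have /sigma_finiteP[G [TG ndG Goo]] := sigma_finiteT m.
  exists (fun n => F n `*` G n).
    rewrite -setXTT TF TG predeqE => -[x y]; split.
      move=> [/= [n _ Fnx] [k _ Gky]]; exists (maxn n k) => //; split.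
      - by move: x Fnx; exact/subsetPset/ndF/leq_maxl.
      - by move: y Gky; exact/subsetPset/ndG/leq_maxr.
    by move=> [n _ []/= ? ?]; split; exists n.
  move=> k; have [? ?] := Foo k; have [? ?] := Goo k.
  split; first exact: measurableX.
  by rewrite /P/= product_measure1E// lte_mul_pinfty// ge0_fin_numE.
pose C (p : measurableTypeR R * d.-tuple R) : d.+1.-tuple R := cons_pair p.
have mC : measurable_fun setT C by exact: measurable_cons_pair.
pose QM : {measure set (d.+1.-tuple R) -> \bar R} :=
  measure_function_pushforward__canonical__measure_function_Measure P mC.
have sQ : sigma_finite setT QM.
  have [F TF mF] := Poo.
  exists (fun n => @uncons_pair R d @^-1` (F n)).
    by rewrite -preimage_bigcup -TF preimage_setT.
  move=> n; have [mFn Fn] := mF n; split.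
    by rewrite -[X in measurable X]setTI; exact: measurable_uncons_pair.
  rewrite /QM/= /pushforward -comp_preimage (_ : _ \o _ = idfun)//.
  by apply/funext => p; exact: cons_pairK.
pose QS : {sigma_finite_measure set (d.+1.-tuple R) -> \bar R} :=
  HB.pack (QM : set (d.+1.-tuple R) -> \bar R) QM
    (Measure_isSigmaFinite.Build _ _ _ QM sQ).
by exists QS; rewrite /= lm.
Qed.

Let lebesgue_tuple0 d : lebesgue_tuple R d set0 = 0%E.
Proof. by have [m ->] := lebesgue_tuple_sigma_finite_measure d. Qed.

Let lebesgue_tuple_ge0 d A : (0 <= lebesgue_tuple R d A)%E.
Proof.
have [m ->] := lebesgue_tuple_sigma_finite_measure d.
exact: measure_ge0.
Qed.

Let lebesgue_tuple_semi_sigma_additive d :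
  semi_sigma_additive (lebesgue_tuple R d).
Proof.
have [m ->] := lebesgue_tuple_sigma_finite_measure d.
exact: measure_semi_sigma_additive.
Qed.

HB.instance Definition _ d := isMeasure.Build _ _ _ (lebesgue_tuple R d)
  (lebesgue_tuple0 d) (@lebesgue_tuple_ge0 d)
  (@lebesgue_tuple_semi_sigma_additive d).

Let lebesgue_tuple_sigma_finite d : sigma_finite setT (lebesgue_tuple R d).
Proof.
have [m ->] := lebesgue_tuple_sigma_finite_measure d.
exact: sigma_finiteT.
Qed.

HB.instance Definition _ d := Measure_isSigmaFinite.Build _ _ _
  (lebesgue_tuple R d) (@lebesgue_tuple_sigma_finite d).

Lemma lebesgue_tuple_box d (A : 'I_d -> set R) :
  (forall i, measurable (A i)) ->
  lebesgue_tuple R d [set t | forall i, A i (tnth t i)] =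
    (\prod_(i < d) lebesgue_measure (A i))%E.
Proof.
elim: d A => [|d IH] A mA.
  by rewrite big_ord0 /= diracE mem_set//= => -[].
rewrite big_ord_recl -IH//.
pose B := [set t : d.-tuple R | forall i, A (lift ord0 i) (tnth t i)].
have mB : measurable B.
  rewrite (_ : B = \bigcap_(i in [set: 'I_d])
      ((fun t : d.-tuple R => tnth t i) @^-1` A (lift ord0 i))).
    apply: fin_bigcap_measurable => // i _.
    by rewrite -[X in measurable X]setTI; exact: measurable_tnth.
  by apply/seteqP; split => t /= At i; [move=> _|]; exact: At.
transitivity ((@lebesgue_measure R \x lebesgue_tuple R d)%E (A ord0 `*` B)).
  rewrite /= /pushforward; congr (_ _); apply/seteqP; split=> -[x t] /=.
    move=> At; split; first exact: (At ord0).
    by move=> i; have := At (lift ord0 i); rewrite tnthS.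
  by move=> [Ax At] i; case: (unliftP ord0 i) => [j|] -> //; rewrite tnthS.
rewrite product_measure1E//; exact: (mA ord0).
Qed.

End lebesgue_tuple_measure.

Section fourier.
Context (R : realType).

Section dimension.
Context (d : nat).

(* T^d with T = [-pi, pi]. *)
Definition torus : set (d.-tuple R) :=
  [set x | forall i, tnth x i \in `[(- pi)%R, pi]].

(* f is in L_1(T^d); only the values of f on [-pi, pi]^d matter. *)
Definition L1_torus (f : d.-tuple R -> R[i]) : Prop :=
  [/\ measurable_fun torus (fun x => complex.Re (f x)),
      measurable_fun torus (fun x => complex.Im (f x)) &
      (\int[lebesgue_tuple R d]_(x in torus) (Normc.normc (f x))%:E < +oo)%E].

Definition integral_torus (f : d.-tuple R -> R[i]) : R[i] :=
  (\int[lebesgue_tuple R d]_(x in torus) complex.Re (f x)) +i*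
  (\int[lebesgue_tuple R d]_(x in torus) complex.Im (f x)).

Definition expi (t : R) : R[i] := cos t +i* sin t.

Definition dot (k : d.-tuple int) (x : d.-tuple R) : R :=
  \sum_(i < d) (tnth k i)%:~R * tnth x i.

Definition fourier_coef (f : d.-tuple R -> R[i]) (k : d.-tuple int) : R[i] :=
  ((2 * pi) ^- d)%:C * integral_torus (fun x => f x * expi (- dot k x)).

Definition frequencies (n : d.-tuple nat) : set (d.-tuple int) :=
  [set k | forall i, (`|tnth k i| <= tnth n i)%N].

(* The finite-support sum in riesz_mean below is thus a genuine finite sum. *)
Lemma finite_frequencies (n : d.-tuple nat) : finite_set (frequencies n).
Proof.
pose M := (\max_(i < d) tnth n i)%N.
pose h (g : {ffun 'I_d -> 'I_(M + M).+1}) : d.-tuple int :=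
  [tuple ((g i : nat)%:Z - M%:Z)%R | i < d].
apply: (@sub_finite_set _ _ [set h g | g in [set: {ffun 'I_d -> 'I_(M + M).+1}]]).
  move=> k kn; exists [ffun i => inord (absz (tnth k i + M%:Z))] => //.
  apply: eq_from_tnth => i; rewrite tnth_mktuple ffunE.
  have kM : (`|tnth k i| <= M)%N.
    by apply: leq_trans (kn i) _; exact: (leq_bigmax i).
  by rewrite inordK; lia.
exact/finite_image/finite_finset.
Qed.

Definition riesz_weight (gamma alpha : R) (n : d.-tuple nat)
    (k : d.-tuple int) : R :=
  \prod_(i < d)
    (1 - (`|tnth k i|%:R / (tnth n i)%:R) `^ gamma) `^ alpha.

Definition riesz_mean (gamma alpha : R) (n : d.-tuple nat)
    (f : d.-tuple R -> R[i]) (x : d.-tuple R) : R[i] :=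
  \sum_(k \in frequencies n)
    (riesz_weight gamma alpha n k)%:C * fourier_coef f k * expi (dot k x).

Definition cone (tau : R) : set (d.-tuple R) :=
  [set x | (forall i, 0 < tnth x i) /\
           (forall i j, tau^-1 <= tnth x i / tnth x j <= tau)].

(* min(n_1, ..., n_d) --> oo *)
Definition min_to_infty : set_system (d.-tuple nat) :=
  [set A | exists N : nat,
    forall n : d.-tuple nat, (forall i, (N <= tnth n i)%N) -> A n].

#[global] Instance min_to_infty_filter : ProperFilter min_to_infty.
Proof.
apply: Build_ProperFilter_ex.
  by move=> A [N NA]; exists [tuple N | i < d]; apply: NA => i; rewrite tnth_mktuple.
split; first by exists 0%N.
  move=> A B [N NA] [M MB]; exists (maxn N M) => n nNM; split.
    by apply: NA => i; exact: leq_trans (leq_maxl _ _) (nNM i).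
  by apply: MB => i; exact: leq_trans (leq_maxr _ _) (nNM i).
by move=> A B AB [N NA]; exists N => n nN; exact/AB/NA.
Qed.

(* n --> oo with n restricted to the cone *)
Definition cone_to_infty (tau : R) : set_system (d.-tuple nat) :=
  within [set n | cone tau (map_tuple (fun m : nat => m%:R) n)] min_to_infty.

Lemma cone_to_infty_filter (tau : R) :
  1 <= tau -> ProperFilter (cone_to_infty tau).
Proof.
move=> tau1; apply: Build_ProperFilter_ex.
  move=> A [N NA]; exists [tuple N.+1 | i < d].
  apply: NA => [i|]; first by rewrite tnth_mktuple.
  split=> [i|i j]; rewrite !tnth_map ?ltr0n//.
have tau0 : 0 < tau by exact: lt_le_trans tau1.
by rewrite divff ?pnatr_eq0// tau1 andbT invf_le1.
Qed.

End dimension.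
End fourier.

(* Main.v *)
Require Import Defs.
From mathcomp Require Import all_boot all_order all_algebra.
From mathcomp Require Import complex ring lra zify.
From mathcomp Require Import all_classical all_reals all_analysis.
From mathcomp Require Import measurable_realfun.
Import Order.TTheory GRing.Theory Num.Theory.
Import numFieldNormedType.Exports.

Set Implicit Arguments.
Unset Strict Implicit.
Unset Printing Implicit Defensive.

Local Open Scope classical_set_scope.
Local Open Scope ring_scope.

(** The means are convolutions: [sigma_n f (x)] is [(2 pi)^-d] times the integral
of [f y] against the product over [i] of [K_(n_i) (x_i - y_i)], where [K_n] is the
cosine polynomial with the weights [(1 - (k/n)^gamma)^alpha] (lemma
[riesz_mean_conv_mean]).  It then suffices to treat the real and imaginary parts
of [f], and almost everywhere convergence of [conv_mean] follows the classical
pattern: a weak type (1,1) inequality for the maximal operator, and convergence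
on a class of functions that is dense in [L_1].

Kernel estimate ([riesz_kernel_decay]).  Write [alpha = beta * p] with [p] a
natural number and [0 < beta <= 1].  Since [gamma >= 1], the sequence
[v_k = (1 - (k/n)^gamma)^beta] is concave and decreasing, and the weights are
[v_k ^ p].  One summation by parts turns [sin (t/2) * K_n t] into the sum of
[(w_k - w_(k+1)) sin ((k + 1/2) t)].  Cutting this sum at distance
[j ~ 1 / |sin (t/2)|] from its end, applying Abel's inequality before the cut and
telescoping after it gives [|K_n t| <= C n (n |sin (t/2)|)^-(1 + beta)].

Maximal inequality ([conv_mean_weak_type]).  On the cone all the [n_i] are
comparable to one integer [N].  By the kernel estimate the product kernel is
dominated by the sum over [k] in [N^d] of [N^d 2^-|k| q^(2|k|)] times the indicator
of the box with half-sides [2^(k_i) / N], where [q = 2^(-beta/2) < 1].  For a fixed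
[k] these boxes are dilates of a single box, so Vitali's covering argument yields
a weak type inequality whose constant does not depend on [k]
([maximal_inequality]); the factor [q^(2|k|)] is split in two, one half making the
exceptional sets summable and the other making the bounds summable.  The periodic
images of the kernel are avoided by taking [x] in a slightly smaller cube, where
[|sin (t/2)| >= c |t|] for all the differences [t] that occur.

Dense class ([ae_summable_indic]).  For a product of sets on the line, Fubini's
theorem factors the mean into one-dimensional means, which converge off the
boundary because the kernel has integral [2 pi] and decays away from the origin.
The sets whose indicator is summed almost everywhere form a lambda-system by the
maximal inequality, hence contain all measurable sets; simple functions and [L_1]
limits follow. *)

(** * Summation by parts and cosine sums *)

Section summation_by_parts.
Context (R : realType).
Implicit Types (a b v w : nat -> R) (t s : R).

Lemma abel_summation a b m :
  \sum_(k < m.+1) a k * b k =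
  a m * \sum_(k < m.+1) b k + \sum_(k < m) (a k - a k.+1) * \sum_(i < k.+1) b i.
Proof.
elim: m => [|m IH]; first by rewrite !big_ord1 big_ord0 addr0.
rewrite big_ord_recr IH [in RHS]big_ord_recr /=.
rewrite [\sum_(k < m.+1) (a k - _) * _]big_ord_recr /=.
rewrite mulrDr mulrBl; ring.
Qed.

Lemma abel_bound a b m B : (forall j, (j <= m.+1)%N -> `|\sum_(i < j) b i| <= B) ->
  `|\sum_(k < m.+1) a k * b k| <= (`|a m| + \sum_(k < m) `|a k - a k.+1|) * B.
Proof.
move=> bB; rewrite abel_summation mulrDl mulr_suml.
apply: le_trans (ler_normD _ _) _; apply: lerD.
  by rewrite normrM ler_wpM2l// bB.
apply: le_trans (ler_norm_sum _ _ _) _; apply: ler_sum => k _.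
by rewrite normrM ler_wpM2l// bB// ltnS ltnW.
Qed.

Lemma abel_nonincreasing a b m B :
  (forall k, (k < m)%N -> a k.+1 <= a k) -> 0 <= a m ->
  (forall j, (j <= m.+1)%N -> `|\sum_(i < j) b i| <= B) ->
  `|\sum_(k < m.+1) a k * b k| <= a 0%N * B.
Proof.
move=> da am bB; apply: le_trans (abel_bound _ bB) _.
rewrite (eq_bigr (fun k : 'I_m => - (a k.+1 - a k))).
  by rewrite sumrN -(big_mkord xpredT (fun k => a k.+1 - a k)) telescope_sumr//
    ger0_norm// opprB addrC subrK.
by move=> k _; rewrite ger0_norm ?opprB// subr_ge0 da.
Qed.

Lemma abel_nondecreasing a b m B :
  (forall k, (k < m)%N -> a k <= a k.+1) -> 0 <= a 0%N ->
  (forall j, (j <= m.+1)%N -> `|\sum_(i < j) b i| <= B) ->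
  `|\sum_(k < m.+1) a k * b k| <= 2 * a m * B.
Proof.
move=> da a0 bB; apply: le_trans (abel_bound _ bB) _.
have a0m : a 0%N <= a m.
  elim: m da {bB} => // m IH da; apply: le_trans (da m _) => //.
  by apply: IH => k km; apply: da; exact: ltnW.
have B0 : 0 <= B by apply: le_trans (bB 0%N _).
apply: ler_wpM2r => //.
rewrite (eq_bigr (fun k : 'I_m => a k.+1 - a k)).
  rewrite -(big_mkord xpredT (fun k => a k.+1 - a k)) telescope_sumr//.
  by rewrite ger0_norm; lra.
by move=> k _; rewrite distrC ger0_norm// subr_ge0 da.
Qed.

End summation_by_parts.

Section cosine_sums.
Context (R : realType).
Implicit Types (v w : nat -> R) (t : R).

Definition cos_kernel w (n : nat) t : R :=
  w 0%N + 2 * \sum_(k < n) w k.+1 * cos (k.+1%:R * t).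

(** Abel summation against the Dirichlet kernels: multiplying by [sin (t/2)] makes
each cosine a difference of two sines, so the weights enter only through their
differences and the boundary term. *)
Lemma sin_half_cos_kernel w n t :
  sin (t / 2) * cos_kernel w n t =
  \sum_(k < n) (w k - w k.+1) * sin ((k%:R + 2^-1) * t)
  + w n * sin ((n%:R + 2^-1) * t).
Proof.
elim: n => [|n IH].
  rewrite /cos_kernel !big_ord0 mulr0 addr0 add0r mulrC add0r.
  by congr (_ * sin _); rewrite mulrC.
have -> : cos_kernel w n.+1 t =
    cos_kernel w n t + 2 * w n.+1 * cos (n.+1%:R * t).
  by rewrite /cos_kernel big_ord_recr /= mulrDr addrA mulrA.
rewrite mulrDr IH big_ord_recr /=.
have -> : (n.+1%:R + 2^-1) * t = n.+1%:R * t + t / 2 by field.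
have -> : (n%:R + 2^-1) * t = n.+1%:R * t - t / 2 by rewrite -natr1; field.
rewrite sinB sinD; ring.
Qed.

Lemma sin_half_sum_sin m t :
  2 * sin (t / 2) * \sum_(k < m) sin ((k%:R + 2^-1) * t) = 1 - cos (m%:R * t).
Proof.
elim: m => [|m IH]; first by rewrite big_ord0 mulr0 mul0r cos0 subrr.
rewrite big_ord_recr /= mulrDr IH.
have -> : (m%:R + 2^-1) * t = m%:R * t + t / 2 by field.
have -> : m.+1%:R * t = m%:R * t + t / 2 + t / 2 by rewrite -natr1; field.
rewrite sinD (cosD (_ + _)) cosD sinD.
have := cos2Dsin2 (t / 2); set S := sin (t / 2); set C := cos (t / 2) => E.
set c := cos (m%:R * t); set u := sin (m%:R * t).
apply/eqP; rewrite -subr_eq0; apply/eqP.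
by transitivity (c * (C ^+ 2 + S ^+ 2 - 1)); [ring | rewrite E subrr mulr0].
Qed.

Lemma sum_sin_bound m t : sin (t / 2) != 0 ->
  `|\sum_(k < m) sin ((k%:R + 2^-1) * t)| <= `|sin (t / 2)|^-1.
Proof.
move=> s0; have := sin_half_sum_sin m t.
set S := \sum_(_ < _) _ => E; rewrite -[leRHS]mulr1 ler_pdivlMl ?normr_gt0//.
rewrite -normrM.
have -> : sin (t / 2) * S = (1 - cos (m%:R * t)) / 2 by rewrite -E; field.
by rewrite ler_norml; have := cos_le1 (m%:R * t); have := cos_geN1 (m%:R * t); lra.
Qed.

Lemma cos_kernel_le w n t :
  (forall k, (k <= n)%N -> `|w k| <= 1) -> `|cos_kernel w n t| <= 1 + 2 * n%:R.
Proof.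
move=> w1; apply: le_trans (ler_normD _ _) _; apply: lerD; first exact: w1.
rewrite normrM ger0_norm// ler_wpM2l//.
apply: le_trans (ler_norm_sum _ _ _) _.
rewrite -[n in leRHS]card_ord -sum1_card natr_sum; apply: ler_sum => k _.
rewrite normrM -[1%:R]mul1r; apply: ler_pM => //; first exact: w1.
by rewrite ler_norml cos_geN1 cos_le1.
Qed.

(** The weights are [v ^ p] with [v] concave and decreasing, which covers every
positive exponent: [v_k ^ p - v_(k+1) ^ p] is the product of the nondecreasing
[e k = v_k - v_(k+1)] and a nonincreasing factor [g k] bounded by [p]. *)
Section concave_weight.
Variables (v : nat -> R) (n p : nat).
Hypothesis vn : v n = 0.
Hypothesis dv : forall k, (k < n)%N -> v k.+1 <= v k.
Hypothesis cv : forall k, (k.+1 < n)%N -> v k - v k.+1 <= v k.+1 - v k.+2.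
Hypothesis v0 : v 0%N <= 1.

Let e k := v k - v k.+1.
Let g k := \sum_(i < p) v k ^+ (p.-1 - i) * v k.+1 ^+ i.

Let dve k l : (k <= l <= n)%N -> v l <= v k.
Proof.
move=> /andP[]; elim: l => [|l IH]; first by rewrite leqn0 => /eqP ->.
rewrite leq_eqVlt => /predU1P[->//|kl] ln.
by apply: le_trans (dv ln) _; apply: IH => //; exact: ltnW.
Qed.

Let v_ge0 k : (k <= n)%N -> 0 <= v k.
Proof. by move=> kn; rewrite -vn dve// kn leqnn. Qed.

Let v_le1 k : (k <= n)%N -> v k <= 1.
Proof. by move=> kn; apply: le_trans v0; rewrite dve. Qed.

Let diff_expE k : v k ^+ p - v k.+1 ^+ p = e k * g k.
Proof. by rewrite subrXX /e /g; case: p => [|q]; rewrite ?big_ord0. Qed.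

Let g_ge0 k : (k < n)%N -> 0 <= g k.
Proof.
by move=> kn; apply: sumr_ge0 => i _; rewrite mulr_ge0// exprn_ge0// v_ge0// ltnW.
Qed.

Let g_noninc k : (k.+1 < n)%N -> g k.+1 <= g k.
Proof.
move=> kn; apply: ler_sum => i _; apply: ler_pM; rewrite ?exprn_ge0 ?v_ge0//.
- exact: ltnW.
- by rewrite lerXn2r ?nnegrE ?v_ge0 ?dv// ltnW// ltnW.
- by rewrite lerXn2r ?nnegrE ?v_ge0 ?dv// ltnW// ltnW.
Qed.

Let g_le k : (k < n)%N -> g k <= p%:R.
Proof.
move=> kn; rewrite -[p in leRHS]card_ord -sum1_card natr_sum.
apply: ler_sum => i _; rewrite -[1%:R]mul1r.
by apply: ler_pM; rewrite ?exprn_ge0 ?exprn_ile1 ?v_ge0 ?v_le1// ltnW.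
Qed.

Let e_ge0 k : (k < n)%N -> 0 <= e k. Proof. by move=> kn; rewrite subr_ge0 dv. Qed.

Let e_nondec k l : (k <= l < n)%N -> e k <= e l.
Proof.
move=> /andP[]; elim: l => [|l IH]; first by rewrite leqn0 => /eqP ->.
rewrite leq_eqVlt => /predU1P[->//|kl] ln.
by apply: le_trans (cv ln); apply: IH => //; exact: ltnW.
Qed.

Let e_le m j : (m.+1 + j)%N = n -> j%:R * e m <= v m.+1.
Proof.
move=> mjn; have -> : v m.+1 = \sum_(i < j) e (m.+1 + i)%N.
  rewrite (eq_bigr (fun i : 'I_j => - (v (m.+1 + i.+1)%N - v (m.+1 + i)%N))).
    rewrite sumrN -(big_mkord xpredT (fun i => v (m.+1 + i.+1)%N - v (m.+1 + i)%N)).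
    by rewrite (telescope_sumr (fun i => v (m.+1 + i)%N))// mjn vn addn0 sub0r opprK.
  by move=> i _; rewrite opprB /e addnS.
rewrite -[j in j%:R]card_ord -sum1_card natr_sum mulr_suml; apply: ler_sum => i _.
rewrite mul1r; apply: e_nondec; rewrite -mjn ltn_add2l ltn_ord andbT.
by rewrite -addn1 -addnA leq_addr.
Qed.

(** Before the cut at [n - j], Abel's inequality, used once for the decreasing [g] and
once for the increasing [e], bounds the sum by [2 p e_(n-j-1) / |sin (t/2)|], and
concavity gives [j e_(n-j-1) <= v_(n-j)].  After the cut the differences telescope
to [v_(n-j) ^ p].  The choice [j >= 1 / |sin (t/2)|] balances the two. *)
Lemma concave_kernel_bound j t : (0 < j <= n)%N -> (0 < p)%N ->
  sin (t / 2) != 0 -> `|sin (t / 2)|^-1 <= j%:R ->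
  `|sin (t / 2)| * `|cos_kernel (fun k => v k ^+ p) n t| <=
  (1 + 2 * p%:R) * v (n - j)%N.
Proof.
move=> /andP[j0 jn] p0 s0 sj; rewrite -normrM sin_half_cos_kernel.
rewrite vn expr0n gtn_eqF// mul0r addr0.
pose F k := (v k ^+ p - v k.+1 ^+ p) * sin ((k%:R + 2^-1) * t).
rewrite -(big_mkord xpredT F) (big_cat_nat (n := n - j))//= ?leq_subr//.
rewrite addrC mulrDl mul1r.
apply: le_trans (ler_normD _ _) _; apply: lerD.
  apply: le_trans (ler_norm_sum _ _ _) _.
  apply: (@le_trans _ _ (\sum_((n - j)%N <= k < n) - (v k.+1 ^+ p - v k ^+ p))).
    rewrite big_nat_cond [leRHS]big_nat_cond; apply: ler_sum => k.
    rewrite andbT => /andP[_ kn].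
    rewrite /F normrM opprB ger0_norm; last first.
      by rewrite subr_ge0 lerXn2r ?nnegrE ?v_ge0 ?dv// ltnW.
    rewrite -[leRHS]mulr1 ler_wpM2l//; last by rewrite ler_norml sin_geN1 sin_le1.
    by rewrite subr_ge0 lerXn2r ?nnegrE ?v_ge0 ?dv// ltnW.
  rewrite sumrN (telescope_sumr (fun k => v k ^+ p)) ?leq_subr//.
  rewrite vn expr0n gtn_eqF// sub0r opprK.
  by rewrite ler_iXnr// ?v_ge0 ?v_le1 ?leq_subr.
case E : (n - j)%N => [|m].
  by rewrite big_geq// normr0 mulr_ge0 ?mulr_ge0// v_ge0.
have mn : (m.+1 <= n)%N by rewrite -E leq_subr.
rewrite big_mkord (eq_bigr (fun k : 'I_m.+1 => g k * (e k * sin ((k%:R + 2^-1) * t)))).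
  apply: (@le_trans _ _ (g 0%N * (2 * e m * `|sin (t / 2)|^-1))).
    apply: (@abel_nonincreasing _ g (fun k => e k * sin ((k%:R + 2^-1) * t))).
    - by move=> k km; apply: g_noninc; apply: leq_trans mn.
    - exact: g_ge0.
    move=> [|i] im.
      by rewrite big_ord0 normr0 mulr_ge0// mulr_ge0// e_ge0.
    apply: (@le_trans _ _ (2 * e i * `|sin (t / 2)|^-1)).
      apply: (@abel_nondecreasing _ e (fun k => sin ((k%:R + 2^-1) * t))).
      - move=> k ki; apply: e_nondec; rewrite leqnSn/=.
        by apply: leq_trans mn; apply: leq_trans im.
      - by apply: e_ge0; apply: leq_trans mn.
      - by move=> l _; exact: sum_sin_bound.
    by rewrite ler_wpM2r ?invr_ge0// ler_wpM2l// e_nondec// -ltnS im.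
  have H : j%:R * e m <= v m.+1 by apply: e_le; rewrite -E subnK.
  rewrite (_ : _ * _ = 2 * (g 0%N * (e m * `|sin (t / 2)|^-1))); last by ring.
  rewrite -[leRHS]mulrA; apply: ler_wpM2l => //.
  apply: ler_pM; rewrite ?g_ge0 ?g_le ?mulr_ge0 ?e_ge0 ?invr_ge0//.
  - by apply: leq_trans mn.
  - by apply: leq_trans mn.
  by apply: le_trans H; rewrite mulrC ler_wpM2r// e_ge0//; apply: leq_trans mn.
by move=> k _; rewrite /F diff_expE mulrAC mulrC mulrA.
Qed.

End concave_weight.
End cosine_sums.

(** * Decay of the Riesz kernel *)

Section sine_lower_bound.
Context (R : realType).

Lemma sin_ge_small (u : R) : 0 <= u <= 1 -> cos 1 * u <= sin u.
Proof.
move=> /andP[u0 u1].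
have [c cu] := MVT_segment u0 (fun x _ => is_derive_sin x)
  (continuous_subspaceT (@continuous_sin R)).
rewrite sin0 !subr0 => ->; apply: ler_wpM2r => //.
have := cu; rewrite in_itv/= => /andP[c0 cu'].
have := pihalf_ge1 R => p1.
have c1 : c <= 1 by exact: le_trans cu' u1.
have : ~~ (cos c < cos 1) by rewrite ltr_cos ?in_itv/=; try lra; rewrite -leNgt.
by rewrite -leNgt.
Qed.

(** The kernel is periodic and has another singularity at [2 pi]; keeping [t] at
distance [delta] from it costs only a constant. *)
Lemma sin_ge_linear (delta : R) : 0 < delta ->
  exists2 c : R, 0 < c &
    forall t, `|t| <= 2 * pi - delta -> c * `|t| <= `|sin (t / 2)|.
Proof.
move=> d0; wlog dpi : delta d0 / delta <= pi.
  move=> H; have [|dpi] := leP delta pi; first exact: H.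
  have [c c0 Hc] := H pi (pi_gt0 R) (lexx _).
  by exists c => // t tp; apply: Hc; lra.
have c1 := cos1_gt0 R; have p0 := pi_gt0 R; have p1 := pihalf_ge1 R.
have p2 := pihalf_lt2 R.
have s1 : 0 < sin (1 : R) by rewrite sin_gt0_pi//; lra.
pose k : R := cos 1 * (sin 1 / pi).
have k0 : 0 < k by rewrite mulr_gt0// divr_gt0.
have half (u : R) : 0 <= u <= pi / 2 -> k * u <= sin u.
  move=> /andP[u0 u1].
  have [u2|u2] := leP u 1.
    apply: le_trans (sin_ge_small _); last by rewrite u0.
    rewrite /k -mulrA ler_pM2l// ler_piMl// ler_pdivrMr//.
    by rewrite mul1r (le_trans (sin_le1 _))//; lra.
  apply: (@le_trans _ _ (sin 1)).
    rewrite /k -mulrA -[leRHS]mul1r; apply: ler_pM; rewrite ?cos_le1 ?(ltW c1)//.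
      by rewrite mulr_ge0// divr_ge0// ltW.
    by rewrite mulrAC ler_pdivrMr// ler_wpM2l ?(ltW s1)//; lra.
  have : ~~ (sin u < sin 1) by rewrite ltr_sin ?in_itv/=; try lra; rewrite -leNgt ltW.
  by rewrite -leNgt.
pose r := delta / (4 * pi).
have r0 : 0 < r by rewrite divr_gt0// mulr_gt0.
have r4 : r <= 4^-1 by rewrite ler_pdivrMr ?mulr_gt0//; lra.
have rpi : r * (2 * pi) = delta / 2.
  have : r * (4 * pi) = delta by rewrite divfK// mulf_neq0// gt_eqF.
  by rewrite !mulrA ![r * _]mulrC -!mulrA; set rp := r * pi; lra.
exists (k * r); first by rewrite mulr_gt0.
move=> t td.
have -> : `|sin (t / 2)| = `|sin (`|t| / 2)|.
  by have [?|?] := ger0P t => //; rewrite mulNr sinN normrN.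
move: td; have := normr_ge0 t; set u := `|t| => u0 ud.
apply: le_trans (ler_norm _).
have [uh|uh] := leP u pi.
  apply: le_trans (half (u / 2) _); last by lra.
  rewrite -mulrA ler_pM2l// mulrC ler_wpM2l//; lra.
have -> : sin (u / 2) = sin (pi - u / 2) by rewrite sinB sinpi cospi; ring.
apply: le_trans (half (pi - u / 2) _); last by lra.
rewrite -mulrA ler_pM2l//.
apply: (@le_trans _ _ (r * (2 * pi))); last by rewrite rpi; lra.
by rewrite ler_pM2l//; lra.
Qed.

End sine_lower_bound.

Section riesz_kernel.
Context (R : realType).
Implicit Types (x y u t : R).

Lemma powR_midpoint_convex p x y : 1 <= p -> 0 <= x -> 0 <= y ->
  ((x + y) / 2) `^ p <= (x `^ p + y `^ p) / 2.
Proof.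
move=> p1 x0 y0.
have h0 : 0 <= 2^-1 :> R by lra.
have h1 : 2^-1 <= 1 :> R by lra.
have xp : x \in (`[0, +oo[%classic : set R) by rewrite inE/= in_itv/= x0.
have yp : y \in (`[0, +oo[%classic : set R) by rewrite inE/= in_itv/= y0.
have H : (2^-1 * x + (1 - 2^-1) * y) `^ p <=
    2^-1 * x `^ p + (1 - 2^-1) * y `^ p := convex_powR p1 (Itv01 h0 h1) xp yp.
have h2 : 1 - 2^-1 = 2^-1 :> R by lra.
by move: H; rewrite h2 -!mulrDr mulrC [leRHS]mulrC.
Qed.

(** Midpoint convexity of the inverse power, read backwards. *)
Lemma powR_midpoint_concave b x y : 0 < b <= 1 -> 0 <= x -> 0 <= y ->
  (x `^ b + y `^ b) / 2 <= ((x + y) / 2) `^ b.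
Proof.
move=> /andP[b0 b1] x0 y0.
have bV : 1 <= b^-1 by rewrite invf_ge1.
have := powR_midpoint_convex bV (powR_ge0 x b) (powR_ge0 y b).
rewrite -!powRrM divff ?gt_eqF// !powRr1//.
move=> /(ge0_ler_powR (ltW b0)); rewrite -powRrM mulVf ?gt_eqF// powRr1; last first.
  by rewrite divr_ge0// addr_ge0// powR_ge0.
by apply; rewrite nnegrE ?powR_ge0// divr_ge0// addr_ge0.
Qed.

Lemma one_sub_exp_le (p : nat) u : 0 <= u <= 1 -> 1 - u ^+ p <= p%:R * (1 - u).
Proof.
move=> /andP[u0 u1]; elim: p => [|p IH]; first by rewrite expr0 subrr mul0r.
have -> : 1 - u ^+ p.+1 = (1 - u ^+ p) + u ^+ p * (1 - u) by rewrite exprSr; ring.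
rewrite -natr1 mulrDl mul1r lerD// ler_piMl ?subr_ge0//.
by rewrite exprn_ile1.
Qed.

Lemma one_sub_powR_le g (p : nat) u : 1 <= g -> g <= p%:R -> 0 <= u <= 1 ->
  1 - u `^ g <= p%:R * (1 - u).
Proof.
move=> g1 gp u01; apply: le_trans (one_sub_exp_le p u01).
have /andP[u0 u1] := u01.
rewrite lerD2l lerN2 -powR_mulrn//; move: u0; rewrite le_eqVlt => /predU1P[<-|u0].
  have g0 : 0 < g by apply: lt_le_trans g1.
  by rewrite !powR0 ?gt_eqF// (lt_le_trans g0).
by apply: ger_powR gp; rewrite u0.
Qed.

Definition riesz_profile (gamma alpha : R) (n k : nat) : R :=
  (1 - (k%:R / n%:R) `^ gamma) `^ alpha.

Definition riesz_kernel (gamma alpha : R) (n : nat) (t : R) : R :=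
  cos_kernel (riesz_profile gamma alpha n) n t.

Section profile.
Variables (gamma : R) (gamma1 : 1 <= gamma).

Let gamma_gt0 : 0 < gamma. Proof. exact: lt_le_trans gamma1. Qed.

Let ratio01 n k : (0 < n)%N -> (k <= n)%N -> 0 <= (k%:R / n%:R : R) <= 1.
Proof.
by move=> n0 kn; rewrite divr_ge0//= ler_pdivrMr ?ltr0n// mul1r ler_nat.
Qed.

Let base01 n k : (0 < n)%N -> (k <= n)%N ->
  0 <= 1 - (k%:R / n%:R) `^ gamma <= 1.
Proof.
move=> n0 kn; have /andP[u0 u1] := ratio01 n0 kn.
rewrite subr_ge0 lerBlDr lerDl powR_ge0 andbT.
have := ge0_ler_powR (ltW gamma_gt0) (x := k%:R / n%:R) (y := 1).
by rewrite powR1; apply; rewrite ?nnegrE.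
Qed.

Lemma riesz_profile01 alpha n k : 0 < alpha -> (0 < n)%N -> (k <= n)%N ->
  0 <= riesz_profile gamma alpha n k <= 1.
Proof.
move=> a0 n0 kn; rewrite powR_ge0/=; have /andP[u0 u1] := base01 n0 kn.
have := ge0_ler_powR (ltW a0) (x := 1 - (k%:R / n%:R) `^ gamma) (y := 1).
by rewrite powR1; apply; rewrite ?nnegrE.
Qed.

Lemma riesz_profile_last alpha n : 0 < alpha -> (0 < n)%N ->
  riesz_profile gamma alpha n n = 0.
Proof.
move=> a0 n0; rewrite /riesz_profile divff ?pnatr_eq0 -?lt0n// powR1 subrr.
by rewrite powR0// gt_eqF.
Qed.

Lemma riesz_profile0 alpha n : riesz_profile gamma alpha n 0 = 1.
Proof. by rewrite /riesz_profile mul0r powR0 ?gt_eqF// subr0 powR1. Qed.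

Lemma riesz_profile_noninc alpha n k : 0 < alpha -> (k < n)%N ->
  riesz_profile gamma alpha n k.+1 <= riesz_profile gamma alpha n k.
Proof.
move=> a0 kn; have n0 : (0 < n)%N by case: n kn.
have /andP[u0 u1] := base01 n0 kn; have /andP[v0 v1] := base01 n0 (ltnW kn).
apply: ge0_ler_powR; rewrite ?nnegrE ?(ltW a0)// lerD2l lerN2.
apply: ge0_ler_powR; rewrite ?nnegrE ?(ltW gamma_gt0) ?divr_ge0//.
by rewrite ler_pM2r ?invr_gt0 ?ltr0n// ler_nat.
Qed.

(** An increasing concave function of a concave function is concave: [1 - u^gamma] is
concave for [gamma >= 1], and so is its power [beta] for [beta <= 1]. *)
Lemma riesz_profile_concave beta n k : 0 < beta <= 1 -> (k.+1 < n)%N ->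
  riesz_profile gamma beta n k - riesz_profile gamma beta n k.+1 <=
  riesz_profile gamma beta n k.+1 - riesz_profile gamma beta n k.+2.
Proof.
have key1 (a b c : R) : (a + c) / 2 <= b -> a - b <= b - c by lra.
have key2 (a b c : R) : b <= (a + c) / 2 -> (1 - a + (1 - c)) / 2 <= 1 - b by lra.
move=> b01 kn; have n0 : (0 < n)%N by case: n kn.
have /andP[b0 b1] := b01.
have /andP[u0 u1] := base01 n0 kn.
have /andP[v0 v1] := base01 n0 (ltnW kn).
have /andP[w0 w1] := base01 n0 (ltnW (ltnW kn)).
have := powR_midpoint_concave b01 w0 u0.
suff : ((1 - (k%:R / n%:R) `^ gamma + (1 - (k.+2%:R / n%:R) `^ gamma)) / 2) `^ beta
   <= riesz_profile gamma beta n k.+1.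
  move=> h1 h2; have := le_trans h2 h1; rewrite -!/(riesz_profile gamma beta n _).
  exact: key1.
apply: ge0_ler_powR; [exact: ltW| | |].
- by rewrite nnegrE; apply: divr_ge0 => //; exact: addr_ge0.
- by rewrite nnegrE.
have := powR_midpoint_convex gamma1 (x := k%:R / n%:R) (y := k.+2%:R / n%:R).
rewrite -mulrDl -natrD (_ : (k + k.+2)%N = (k.+1 * 2)%N);
  last by rewrite !addnS addnn muln2 doubleS.
rewrite natrM mulrAC mulfK ?pnatr_eq0//.
move=> /(_ (divr_ge0 (ler0n _ _) (ler0n _ _)) (divr_ge0 (ler0n _ _) (ler0n _ _))).
exact: key2.
Qed.

Lemma riesz_profile_near_end beta (p : nat) n j : 0 < beta -> gamma <= p%:R ->
  (0 < n)%N -> (j <= n)%N ->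
  riesz_profile gamma beta n (n - j) <= (p%:R * (j%:R / n%:R)) `^ beta.
Proof.
move=> b0 gp n0 jn; have kn : (n - j <= n)%N by rewrite leq_subr.
have /andP[u0 u1] := base01 n0 kn.
apply: ge0_ler_powR; [exact: ltW|by rewrite nnegrE| |].
  by rewrite nnegrE mulr_ge0// divr_ge0.
apply: le_trans (one_sub_powR_le gamma1 gp (ratio01 n0 kn)) _.
rewrite natrB// mulrBl divff ?pnatr_eq0 -?lt0n//.
by rewrite opprB addrC subrK.
Qed.

Lemma riesz_profile_exp beta (p : nat) n k : (0 < n)%N -> (k <= n)%N ->
  riesz_profile gamma (beta * p%:R) n k = riesz_profile gamma beta n k ^+ p.
Proof. by move=> n0 kn; rewrite /riesz_profile powRrM powR_mulrn// powR_ge0. Qed.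

Lemma riesz_kernel_le3n alpha n t : 0 < alpha -> (0 < n)%N ->
  `|riesz_kernel gamma alpha n t| <= 3 * n%:R.
Proof.
move=> a0 n0; apply: (@le_trans _ _ (1 + 2 * n%:R)).
  apply: cos_kernel_le => k kn.
  by have /andP[? ?] := riesz_profile01 a0 n0 kn; rewrite ger0_norm.
by have : (1 : R) <= n%:R; [rewrite ler1n|lra].
Qed.

End profile.

(** The exponent [beta] is smaller than [alpha] in general: any positive gain over
[1 / t] makes the dyadic sums converge. *)
Lemma riesz_kernel_decay (gamma alpha : R) : 1 <= gamma -> 0 < alpha ->
  exists beta C : R, [/\ 0 < beta, 0 < C & forall (n : nat) t, (0 < n)%N ->
    sin (t / 2) != 0 ->
    `|riesz_kernel gamma alpha n t| <=
    C * n%:R * (n%:R * `|sin (t / 2)|) `^ (- (1 + beta))].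
Proof.
move=> g1 a0.
(* [p] makes [alpha / p] at most one; [P] bounds [gamma] by an integer, so that
   [1 - u^gamma <= P (1 - u)]. *)
pose p := (Num.bound alpha).
have ap : alpha < p%:R by rewrite /p; apply: le_lt_trans (archi_boundP (ltW a0)); rewrite lexx.
pose P := (Num.bound gamma).
have g0 : 0 <= gamma by apply: le_trans g1.
have gP : gamma <= P%:R by apply/ltW/archi_boundP.
have p0 : 0 < p%:R :> R by apply: lt_trans ap.
pose b := alpha / p%:R.
have b0 : 0 < b by rewrite divr_gt0.
have b1 : b <= 1 by rewrite ler_pdivrMr// mul1r ltW.
have aE : alpha = b * p%:R by rewrite divfK// gt_eqF.
pose A : R := (1 + 2 * p%:R) * (P%:R * 2) `^ b.
pose B : R := 3 * 2 `^ (1 + b).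
have A0 : 0 <= A by rewrite mulr_ge0// ?powR_ge0// addr_ge0// mulr_ge0.
have B0 : 0 < B by rewrite mulr_gt0// powR_gt0.
exists b, (A + B); split => //; first by rewrite ltr_wpDl.
move=> n t n0 s0.
set s := `|sin (t / 2)|.
have sgt0 : 0 < s by rewrite normr_gt0.
have nr0 : 0 < n%:R :> R by rewrite ltr0n.
have ns0 : 0 < n%:R * s by rewrite mulr_gt0.
have s1 : s <= 1 by rewrite ler_norml sin_geN1 sin_le1.
(* For [n * s < 2] the trivial bound [3 * n] is already of the right order. *)
have [ns2|ns2] := ltP (n%:R * s) 2.
  apply: le_trans (riesz_kernel_le3n g1 t a0 n0) _.
  apply: (@le_trans _ _ (B * n%:R * (n%:R * s) `^ (- (1 + b)))); last first.
    by rewrite ler_wpM2r ?powR_ge0// ler_wpM2r// lerDr.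
  rewrite powRN ler_pdivlMr ?powR_gt0// /B.
  rewrite mulrAC ler_wpM2r ?ler0n// ler_wpM2l//.
  by apply: ge0_ler_powR; rewrite ?nnegrE ?addr_ge0// ?mulr_ge0// ltW.
pose j := (Num.truncn s^-1).+1.
have sj : s^-1 <= j%:R by rewrite ltW// truncnS_gt.
have j2 : j%:R <= 2 / s.
  rewrite /j -natr1 mulr_natl mulr2n lerD// ?invf_ge1// truncn_le ?invr_ge0//.
  exact: ltW.
have jn : (j <= n)%N.
  by rewrite -(ler_nat R); apply: le_trans j2 _; rewrite ler_pdivrMr.
have := @concave_kernel_bound R (riesz_profile gamma b n) n p
  (riesz_profile_last _ b0 n0) (fun k => riesz_profile_noninc g1 b0)
  (fun k => @riesz_profile_concave _ g1 b n k _) _ j t.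
rewrite b0 b1 riesz_profile0// lexx jn/= => /(_ isT isT isT).
rewrite -(ltr0n R) p0 s0 -/s sj => /(_ isT isT isT).
have -> : cos_kernel (fun k => riesz_profile gamma b n k ^+ p) n t =
    riesz_kernel gamma alpha n t.
  rewrite /riesz_kernel /cos_kernel aE riesz_profile_exp//; congr (_ + _ * _).
  by apply: eq_bigr => i _; rewrite riesz_profile_exp.
move=> H; have v_le := riesz_profile_near_end g1 b0 gP n0 jn.
rewrite -ler_pdivlMl// in H; apply: le_trans H _.
apply: (@le_trans _ _ (A * n%:R * (n%:R * s) `^ (- (1 + b)))); last first.
  by rewrite ler_wpM2r ?powR_ge0// ler_wpM2r// lerDl ltW.
have -> : (n%:R * s) `^ (- (1 + b)) = (n%:R * s)^-1 * (n%:R * s) `^ (- b).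
  rewrite !powRN powRD; last by rewrite (gt_eqF ns0) implybT.
  by rewrite powRr1 ?(ltW ns0)// invfM.
rewrite invfM -[A * _ * _]mulrA.
have -> (X : R) : n%:R * (n%:R^-1 / s * X) = s^-1 * X.
  by rewrite !mulrA divff ?gt_eqF// mul1r.
rewrite [leRHS]mulrCA.
rewrite ler_pM2l ?invr_gt0//.
have q0 : 0 < 1 + 2 * p%:R :> R by rewrite ltr_wpDr// mulr_ge0.
rewrite /A -mulrA (ler_pM2l q0).
apply: le_trans v_le _.
have -> : (n%:R * s) `^ (- b) = ((n%:R * s)^-1) `^ b.
  by rewrite -powR_inv1 ?(ltW ns0)// -powRrM mulN1r.
rewrite -powRM ?mulr_ge0 ?invr_ge0 ?(ltW ns0)//.
apply: ge0_ler_powR; rewrite ?nnegrE ?(ltW b0) ?mulr_ge0 ?invr_ge0 ?(ltW ns0) ?ler0n//.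
rewrite -mulrA ler_wpM2l//.
by rewrite ler_pdivrMr// -[leRHS]mulrA invfM mulrAC mulVf ?gt_eqF// mul1r.
Qed.

End riesz_kernel.

(** * Dyadic form of the kernel estimate *)

Section dyadic_kernel.
Context (R : realType).

(** The scale [N] is common to all coordinates, while [n] is only comparable to it.
The bound on [k] keeps the later sums over [k] finite; it holds because [2^(N+3) / N]
exceeds the length of the period.  The gain [q] appears squared so that one factor
can be given to the exceptional sets and the other to the pointwise bounds. *)
Lemma riesz_kernel_dyadic (gamma alpha tau delta : R) :
  1 <= gamma -> 0 < alpha -> 1 <= tau -> 0 < delta ->
  exists q C : R, [/\ 0 < q < 1, 0 < C & forall (N n : nat) (t : R),
    (0 < N)%N -> (0 < n)%N -> n%:R <= tau * N%:R -> N%:R <= tau * n%:R ->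
    `|t| <= 2 * pi - delta ->
    exists k : nat, [/\ (k < N + 4)%N, `|t| <= 2 ^+ k / N%:R &
      `|riesz_kernel gamma alpha n t| <= C * N%:R * (q ^+ 2 / 2) ^+ k]].
Proof.
move=> g1 a0 tau1 d0.
have [b [C0 [b0 C00 KD]]] := riesz_kernel_decay g1 a0.
have [c c0 sc] := sin_ge_linear d0.
have tau0 : 0 < tau by apply: lt_le_trans tau1.
pose q : R := 2 `^ (- (b / 2)).
have q0 : 0 < q by rewrite powR_gt0.
have q1 : q < 1.
  have : 2 `^ (b / 2) > 1 :> R.
    rewrite -[ltLHS](_ : 1 `^ (b / 2) = 1); last by rewrite powR1.
    apply: gt0_ltr_powR; rewrite ?nnegrE ?divr_gt0//.
    by rewrite ltr1n.
  by rewrite /q powRN => h; rewrite invf_lt1// (lt_trans _ h).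
pose rho := q ^+ 2 / 2.
have rho0 : 0 < rho by rewrite divr_gt0// exprn_gt0.
have rhoE k : (2 ^+ k) `^ (- (1 + b)) = rho ^+ k.
  rewrite -powR_mulrn// -powRrM mulrC powRrM powR_mulrn ?powR_ge0//; congr (_ ^+ _).
  rewrite opprD powRD; last by rewrite pnatr_eq0 implybT.
  rewrite powR_inv1// mulrC /rho /q -powR_mulrn ?powR_ge0// -powRrM.
  by rewrite mulNr divfK.
pose A := C0 * tau * (c / tau) `^ (- (1 + b)) / rho.
have A0 : 0 < A by rewrite divr_gt0// mulr_gt0 ?powR_gt0 ?divr_gt0// mulr_gt0.
exists q, (3 * tau + A); split; rewrite ?q0 ?q1//.
  by rewrite addr_gt0// mulr_gt0.
move=> N n t N0 n0 nN Nn td.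
have Nr0 : 0 < N%:R :> R by rewrite ltr0n.
have nr0 : 0 < n%:R :> R by rewrite ltr0n.
have tN3 : `|t| <= 2 ^+ (N + 3) / N%:R.
  rewrite ler_pdivlMr//; apply: (@le_trans _ _ (8 * N%:R)).
    rewrite ler_pM2r//; apply: le_trans td _.
    by have := pihalf_lt2 R; move: d0; lra.
  rewrite exprD mulrC; apply: ler_pM => //.
    by rewrite -natrX ler_nat ltnW// ltn_expl.
  by rewrite -natrX ler_nat.
have ex : exists k, `|t| <= 2 ^+ k / N%:R by exists (N + 3)%N.
have [k tk kmin] := ex_minnP ex.
exists k; split => //.
  by have := kmin _ tN3; rewrite -ltnS addn3 addn4.
have N0' := ltW Nr0.
case: k tk kmin => [|k] tk kmin.
  rewrite expr0 mulr1; apply: le_trans (riesz_kernel_le3n g1 t a0 n0) _.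
  rewrite [leRHS]mulrDl -[3 * tau * _]mulrA; apply: ler_wpDr; first by rewrite mulr_ge0// ltW.
  by rewrite ler_wpM2l.
have tk' : 2 ^+ k / N%:R < `|t|.
  by rewrite ltNge; apply/negP => /kmin; rewrite ltnn.
have t0 : 0 < `|t| by apply: lt_trans tk'; rewrite divr_gt0// exprn_gt0.
have s0 : 0 < `|sin (t / 2)| by apply: lt_le_trans (sc _ td); rewrite mulr_gt0.
have low : c / tau * 2 ^+ k <= n%:R * `|sin (t / 2)|.
  apply: (@le_trans _ _ (n%:R * (c * (2 ^+ k / N%:R)))); last first.
    rewrite ler_wpM2l//; apply: le_trans (sc _ td); rewrite ler_wpM2l ?(ltW c0)//.
    exact: ltW.
  rewrite mulrCA -[leLHS]mulrA ler_wpM2l ?(ltW c0)// [leRHS]mulrCA mulrC.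
  rewrite ler_wpM2l ?exprn_ge0// -[tau^-1]mul1r ler_pdivrMr// mulrAC ler_pdivlMr//.
  by rewrite mul1r mulrC.
apply: le_trans (KD n t n0 _) _; first by rewrite -normr_gt0.
apply: (@le_trans _ _ (A * N%:R * rho ^+ k.+1)); last first.
  rewrite ler_wpM2r ?exprn_ge0 ?(ltW rho0)// ler_wpM2r// lerDr.
  by rewrite mulr_ge0// ltW.
apply: (@le_trans _ _ (C0 * (tau * N%:R) * (c / tau * 2 ^+ k) `^ (- (1 + b)))).
  apply: ler_pM; rewrite ?mulr_ge0 ?powR_ge0 ?(ltW C00)//.
    by rewrite ler_wpM2l// ltW.
  have b1 : 0 <= 1 + b by rewrite addr_ge0// ltW.
  rewrite !powRN lef_pV2 ?posrE ?powR_gt0//; last first.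
  - by rewrite mulr_gt0// divr_gt0.
  - by rewrite mulr_gt0.
  have l0 : 0 <= c / tau * 2 ^+ k.
    by rewrite mulr_ge0 ?exprn_ge0// divr_ge0// ltW.
  by apply: ge0_ler_powR; rewrite ?nnegrE// (le_trans l0).
rewrite powRM ?exprn_ge0// ?divr_ge0 ?(ltW c0) ?(ltW tau0)// rhoE.
rewrite exprS /A.
have -> (x y z u : R) : x * tau * y / rho * z * (rho * u) = x * (tau * z) * (y * u).
  have -> : x * tau * y / rho * z * (rho * u) =
    (rho^-1 * rho) * (x * (tau * z) * (y * u)) by ring.
  by rewrite mulVf ?gt_eqF// mul1r.
exact: lexx.
Qed.

End dyadic_kernel.

(** * Covering argument and maximal inequality for dilates of a box *)

Section covering.
Local Open Scope ereal_scope.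

Lemma measure_bigcup_ndseq_le d (T : measurableType d) (R : realType)
    (mu : {measure set T -> \bar R}) (F : (set T)^nat) (c : \bar R) :
  (forall i, measurable (F i)) -> nondecreasing_seq F ->
  (forall i, mu (F i) <= c) -> mu (\bigcup_n F n) <= c.
Proof.
move=> mF ndF muc.
have := nondecreasing_cvg_mu (mu := mu) mF (bigcup_measurable (fun i _ => mF i)) ndF.
by move=> /cvge_to_le; apply; near=> n; exact: muc.
Unshelve. all: by end_near. Qed.

Lemma measure_bigsetU_le d (T : measurableType d) (R : realType)
    (mu : {measure set T -> \bar R}) (I : Type) (s : seq I) (F : I -> set T) :
  (forall i, measurable (F i)) ->
  mu (\big[setU/set0]_(i <- s) F i) <= \sum_(i <- s) mu (F i).
Proof.
move=> mF; elim: s => [|i s IH]; first by rewrite !big_nil measure0.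
rewrite !big_cons; apply: le_trans (measureU2 _ _ _) _ => //.
  exact: bigsetU_measurable.
exact: leeD.
Qed.

(** Vitali's covering lemma in measure form.  The indices come with a rank, a smaller
rank meaning a larger set, and [D i] is an enlargement of [B i] that absorbs every
smaller set meeting [B i].  Removing a set of least rank together with everything it
meets, and inducting on the rest, avoids naming the disjoint subfamily. *)
Lemma vitali_finite d (T : measurableType d) (R : realType)
    (mu : {measure set T -> \bar R}) (nu : set T -> \bar R)
    (B D : nat -> set T) (rk : nat -> nat) (c : R) :
  (forall i, measurable (B i)) -> (forall i, measurable (D i)) ->
  (forall A, 0 <= nu A) ->
  (forall A A', measurable A -> measurable A' -> A `<=` A' -> nu A <= nu A') ->
  (forall A A', measurable A -> measurable A' -> A `&` A' = set0 ->
    nu A + nu A' <= nu (A `|` A')) ->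
  (forall i j, (rk i <= rk j)%N -> B i `&` B j !=set0 -> B j `<=` D i) ->
  (0 <= c)%R -> (forall i, mu (D i) <= c%:E * nu (B i)) ->
  forall s : seq nat, mu (\big[setU/set0]_(i <- s) B i) <=
    c%:E * nu (\big[setU/set0]_(i <- s) B i).
Proof.
move=> mB mD nu0 nuS nuU BD c0 muD s.
have mbig (t : seq nat) : measurable (\big[setU/set0]_(i <- t) B i).
  exact: bigsetU_measurable.
have [m] := ubnP (size s); elim: m s => // m IH s; rewrite ltnS => sm.
have [->|sn0] := eqVneq s [::].
  by rewrite big_nil measure0 mule_ge0.
have [i0 i0s i0min] : exists2 i, i \in s & forall j, j \in s -> (rk i <= rk j)%N.
  elim: s sn0 {sm} => // i s IHs _; have [->|sn0] := eqVneq s [::].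
    by exists i; rewrite ?mem_head// => j; rewrite inE => /eqP ->.
  have [k ks kmin] := IHs sn0; have [ik|ki] := leqP (rk i) (rk k).
    exists i; first exact: mem_head.
    by move=> j; rewrite inE => /predU1P[->//|/kmin]; exact: leq_trans.
  exists k; first by rewrite inE ks orbT.
  by move=> j; rewrite inE => /predU1P[->|/kmin//]; exact: ltnW.
pose s' := [seq j <- s | (j != i0) && `[< B i0 `&` B j = set0 >]].
have s'm : (size s' < m)%N.
  apply: leq_trans sm; rewrite size_filter ltn_neqAle count_size andbT.
  by rewrite -all_count; apply/allPn; exists i0; rewrite ?eqxx.
have sub : \big[setU/set0]_(i <- s) B i `<=` D i0 `|` \big[setU/set0]_(i <- s') B i.
  rewrite -!bigcup_seq => x [j /= js Bjx].
  have [B0|] := pselect (B i0 `&` B j = set0); last first.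
    by move=> /eqP/set0P B0; left; apply: (BD i0 j) => //; exact: i0min.
  have [ji0|ji0] := eqVneq j i0.
    have B00 : B i0 = set0 by rewrite -B0 ji0 setIid.
    by move: Bjx; rewrite ji0 B00.
  by right; exists j => //=; rewrite mem_filter ji0 js/= andbT; apply/asboolP.
have dis : B i0 `&` \big[setU/set0]_(i <- s') B i = set0.
  rewrite -bigcup_seq setI_bigcupr; apply: bigcup0 => j /=.
  by rewrite mem_filter => /andP[/andP[_ /asboolP]].
have sub' : B i0 `|` \big[setU/set0]_(i <- s') B i `<=` \big[setU/set0]_(i <- s) B i.
  rewrite -!bigcup_seq => x [Bx|[j/= js' Bx]]; first by exists i0.
  by exists j => //=; move: js'; rewrite mem_filter => /andP[].
apply: le_trans (le_measure _ _ _ sub) _; rewrite ?inE//.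
  exact: measurableU.
apply: le_trans (measureU2 _ _ _) _ => //.
apply: le_trans (leeD (muD i0) (IH _ s'm)) _.
rewrite -ge0_muleDr//; apply: lee_wpmul2l; first by rewrite lee_fin.
apply: le_trans (nuU _ _ _ _ dis) _ => //.
by apply: nuS => //; exact: measurableU.
Qed.

End covering.

Section boxes.
Context (R : realType) (d : nat).
Implicit Types (c r : 'I_d -> R).

Definition box c r : set (d.-tuple R) :=
  [set y | forall i, `|tnth y i - c i| <= r i].

Let box_itv c r : box c r =
  [set y | forall i, [set` `[c i - r i, c i + r i]] (tnth y i)].
Proof.
by apply/seteqP; split=> y /= yb i; have := yb i; rewrite in_itv/= ler_distl.
Qed.

Lemma measurable_setn (A : 'I_d -> set R) : (forall i, measurable (A i)) ->
  measurable [set t : d.-tuple R | forall i, A i (tnth t i)].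
Proof.
move=> mA; rewrite (_ : mkset _ = \bigcap_(i in [set: 'I_d])
    ((fun t : d.-tuple R => tnth t i) @^-1` A i)).
  apply: fin_bigcap_measurable => // i _.
  by rewrite -[X in measurable X]setTI; exact: measurable_tnth.
by apply/seteqP; split => t /= At i; [move=> _|]; exact: At.
Qed.

Lemma measurable_box c r : measurable (box c r).
Proof.
rewrite box_itv.
apply: (@measurable_setn (fun i => [set` `[c i - r i, c i + r i]])) => i.
exact: measurable_itv.
Qed.

Lemma lebesgue_tuple_cube c r : (forall i, 0 <= r i) ->
  lebesgue_tuple R d (box c r) = (\prod_(i < d) (2 * r i))%:E.
Proof.
move=> r0; rewrite box_itv.
rewrite (@lebesgue_tuple_box R d (fun i => [set` `[c i - r i, c i + r i]])) => [|i];
  last exact: measurable_itv.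
rewrite -prodEFin; apply: eq_bigr => i _.
rewrite lebesgue_measure_itv/= lte_fin; have := r0 i.
rewrite le_eqVlt => /predU1P[<-|ri0]; first by rewrite subr0 addr0 ltxx mulr0.
by rewrite ifT; [rewrite -EFinB; congr EFin; ring|lra].
Qed.

End boxes.

Section maximal_inequality.
Context (R : realType) (d : nat).
Local Notation mu := (lebesgue_tuple R d).
Local Open Scope ereal_scope.

(** Weak type (1,1) for averages over the boxes [r / N], with a constant depending
neither on the shape [r] nor on [N].  A box around [x] lies in the box of twice the
size centered at the nearby point of the grid of mesh [r / N], so countably many
boxes suffice and the exceptional set is measurable; intersecting boxes are absorbed
by a factor three, whence sides [12 r / N]. *)
Lemma maximal_inequality (F : d.-tuple R -> \bar R) (r : 'I_d -> R) (lam : R) :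
  measurable_fun setT F -> (forall x, 0 <= F x) ->
  (forall i, 0 < r i)%R ->
  (0 < lam)%R ->
  exists Bad : set (d.-tuple R), [/\ measurable Bad,
    mu Bad <= (12 ^+ d / lam)%:E * \int[mu]_x F x &
    forall x, ~ Bad x -> forall N : nat, (0 < N)%N ->
      \int[mu]_(y in box (tnth x) (fun i => r i / N%:R)%R) F y <=
      (lam * \prod_(i < d) (r i / N%:R))%:E].
Proof.
move=> mF F0 r0 lam0.
pose nu (A : set (d.-tuple R)) := \int[mu]_(y in A) F y.
have mFA A : measurable_fun A F by exact: measurable_funTS.
pose c (p : d.-tuple int * nat) (i : 'I_d) : R :=
  ((tnth p.1 i)%:~R * (r i / p.2.+1%:R))%R.
pose Bx p := box (c p) (fun i => 2 * (r i / p.2.+1%:R))%R.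
pose Dx p := box (c p) (fun i => 6 * (r i / p.2.+1%:R))%R.
pose sel p := (lam * \prod_(i < d) (r i / p.2.+1%:R))%:E < nu (Bx p).
pose idx n : option (d.-tuple int * nat) :=
  if unpickle n is Some p then if `[< sel p >] then Some p else None else None.
pose B n := if idx n is Some p then Bx p else set0.
pose D n := if idx n is Some p then Dx p else set0.
pose rk n := if idx n is Some p then p.2 else 0%N.
have idx_sel n p : idx n = Some p -> sel p.
  by rewrite /idx; case: unpickle => // p'; case: asboolP => // s [<-].
have rN0 i N : (0 < r i / N.+1%:R)%R by rewrite divr_gt0// ltr0n.
have mB n : measurable (B n).
  by rewrite /B; case: (idx _) => // p; exact: measurable_box.
have mD n : measurable (D n).
  by rewrite /D; case: (idx _) => // p; exact: measurable_box.
have nuS A A' : measurable A -> measurable A' -> A `<=` A' -> nu A <= nu A'.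
  by move=> mA mA' AA'; apply: ge0_subset_integral.
have nuU A A' : measurable A -> measurable A' -> A `&` A' = set0 ->
    nu A + nu A' <= nu (A `|` A').
  move=> mA mA' AA'; rewrite /nu ge0_integral_setU//.
  by apply/disj_setPS; rewrite AA'.
have BD i j : (rk i <= rk j)%N -> B i `&` B j !=set0 -> B j `<=` D i.
  rewrite /rk /B /D; case: (idx _) => [p|]; last by move=> _ [z [[]]].
  case: (idx _) => [p'|]; last by move=> _ [z [_ []]].
  move=> pp' [z [zp zp']] y yp' k.
  have := yp' k; have := zp' k; have := zp k.
  have ler : (r k / p'.2.+1%:R <= r k / p.2.+1%:R)%R.
    by rewrite ler_pM2l// lef_pV2 ?posrE ?ltr0n// ler_nat ltnS.
  move: ler; set u := (r k / p.2.+1%:R)%R; set v := (r k / _)%R => vu.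
  rewrite !ler_distl => /andP[a1 a2] /andP[b1 b2] /andP[e1 e2].
  by apply/andP; split; lra.
have K0 : (0 <= 12 ^+ d / lam)%R by rewrite divr_ge0 ?exprn_ge0// ltW.
have muD i : mu (D i) <= (12 ^+ d / lam)%:E * nu (B i).
  rewrite /D /B; case E : (idx i) => [p|]; last first.
    by rewrite measure0 mule_ge0// ?lee_fin// integral_ge0.
  rewrite lebesgue_tuple_cube => [|k]; last by rewrite mulr_ge0// ltW.
  rewrite (_ : (\prod_(k < d) _)%R = (12 ^+ d / lam *
      (lam * \prod_(k < d) (r k / p.2.+1%:R)))%R); last first.
    rewrite mulrA divfK ?gt_eqF//.
    have -> : (12 ^+ d = \prod_(k < d) 12 :> R)%R by rewrite prodr_const card_ord.
    rewrite -big_split/=.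
    by apply: eq_bigr => k _; rewrite mulrA -natrM.
  rewrite EFinM; apply: lee_wpmul2l; first by rewrite lee_fin.
  exact/ltW/(idx_sel _ _ E).
exists (\bigcup_n B n); split.
- exact: bigcup_measurable.
- rewrite -bigcup_bigsetU_bigcup; apply: measure_bigcup_ndseq_le.
  + by move=> n; exact: bigsetU_measurable.
  + by move=> n m nm; apply/subsetPset; exact: subset_bigsetU.
  move=> n; rewrite -(big_mkord xpredT B)/= /index_iota.
  apply: le_trans (vitali_finite (mu := mu) mB mD _ nuS nuU BD K0 muD _) _.
    by move=> A; exact: integral_ge0.
  apply: lee_wpmul2l; first by rewrite lee_fin.
  by apply: nuS => //; exact: bigsetU_measurable.
move=> x xB [//|N] _; rewrite leNgt; apply/negP => big; apply: xB.
pose m := [tuple Num.floor (tnth x i / (r i / N.+1%:R)) | i < d].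
have mx i : (`|tnth x i - c (m, N) i| <= r i / N.+1%:R)%R.
  rewrite /c/= tnth_mktuple; set u := (r i / _)%R.
  have u0 : (0 < u)%R by exact: rN0.
  have := real_floor_itv (num_real (tnth x i / u)%R).
  rewrite ler_pdivlMr// ltr_pdivrMr// => /andP[a1 a2].
  by rewrite ger0_norm ?subr_ge0//; move: a2; rewrite intrD mulrDl mul1r; lra.
exists (pickle (m, N)) => //; rewrite /B /idx pickleK.
case: asboolP => [_ i|[]].
  apply: le_trans (mx i) _; rewrite ler_peMl ?ler1n//; exact: ltW.
apply: lt_le_trans big _; apply: nuS; try exact: measurable_box.
move=> y yx i; rewrite (le_trans (ler_distD (tnth x i) _ _))//.
by rewrite (_ : 2 = 1 + 1)%R// mulrDl mul1r lerD.
Qed.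

End maximal_inequality.

(** * Weak type inequality for the means *)

Section torus.
Context (R : realType) (d : nat).
Local Notation T := (@torus R d).
Local Notation mu := (lebesgue_tuple R d).

Let torus_itv :
  T = [set y | forall i, (fun=> [set` `[- pi, pi : R]]) i (tnth y i)].
Proof. by []. Qed.

Lemma measurable_torus : measurable T.
Proof.
rewrite torus_itv; apply: (@measurable_setn R d (fun=> [set` `[- pi, pi]])) => i.
exact: measurable_itv.
Qed.

Lemma lebesgue_torus : mu T = ((2 * pi) ^+ d)%:E.
Proof.
have -> : T = box (fun=> 0) (fun=> pi).
  by apply/seteqP; split => y yT i; have := yT i; rewrite /= in_itv/= subr0 ler_norml.
by rewrite lebesgue_tuple_cube ?pi_ge0// prodr_const card_ord.
Qed.

Lemma lebesgue_torus_lty : (mu T < +oo)%E.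
Proof. by rewrite lebesgue_torus ltry. Qed.

Lemma torus_le_pi x i : T x -> `|tnth x i| <= pi.
Proof. by move=> /(_ i); rewrite in_itv/= ler_norml. Qed.

End torus.

Section convolution_means.
Context (R : realType) (d : nat) (gamma alpha : R).
Local Notation T := (@torus R d).
Local Notation mu := (lebesgue_tuple R d).

Lemma bounded_by (U : Type) (A : set U) (f : U -> R) (M : R) :
  (forall x, A x -> `|f x| <= M) -> [bounded f x | x in A].
Proof.
move=> fM; exists M; split; first exact: num_real.
by move=> N MN x Ax; apply: le_trans (fM x Ax) _; exact: ltW.
Qed.

Lemma cos_kernel_bounded w n (t : R) :
  `|cos_kernel w n t| <= `|w 0%N| + 2 * \sum_(k < n) `|w k.+1|.
Proof.
apply: le_trans (ler_normD _ _) _; rewrite lerD2l normrM ger0_norm// ler_wpM2l//.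
apply: le_trans (ler_norm_sum _ _ _) _; apply: ler_sum => k _.
by rewrite normrM ler_piMr// ler_norml cos_geN1 cos_le1.
Qed.

Lemma measurable_cos_kernel w n : measurable_fun setT (@cos_kernel R w n).
Proof.
apply: measurable_funD; first exact: measurable_cst.
apply: measurable_funM; first exact: measurable_cst.
apply: measurable_sum => i; apply: measurable_funM; first exact: measurable_cst.
apply: (@measurableT_comp _ _ _ _ _ _ (@cos R)).
  by apply: continuous_measurable_fun; exact: continuous_cos.
by apply: measurable_funM; [exact: measurable_cst|exact: measurable_id].
Qed.

Definition tensor_kernel (n : d.-tuple nat) (x y : d.-tuple R) : R :=
  \prod_(i < d) riesz_kernel gamma alpha (tnth n i) (tnth x i - tnth y i).

Lemma measurable_tensor_kernel n x : measurable_fun setT (tensor_kernel n x).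
Proof.
apply: measurable_prod => i _.
apply: (@measurableT_comp _ _ _ _ _ _ (riesz_kernel gamma alpha (tnth n i))).
  exact: measurable_cos_kernel.
by apply: measurable_funB; [exact: measurable_cst|exact: measurable_tnth].
Qed.

Lemma tensor_kernel_bounded n (A : set (d.-tuple R)) x :
  [bounded tensor_kernel n x y | y in A].
Proof.
pose w i := riesz_profile gamma alpha (tnth n i).
apply: (@bounded_by _ _ _
  (\prod_(i < d) (`|w i 0%N| + 2 * \sum_(k < tnth n i) `|w i k.+1|))).
move=> y _; rewrite normr_prod; apply: ler_prod => i _.
by rewrite normr_ge0/=; exact: cos_kernel_bounded.
Qed.

Definition conv_mean (n : d.-tuple nat) (g : d.-tuple R -> R) (x : d.-tuple R) : R :=
  \int[mu]_(y in T) (g y * tensor_kernel n x y).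

Lemma integrable_conv n x (g : d.-tuple R -> R) : mu.-integrable T (EFin \o g) ->
  mu.-integrable T (EFin \o (fun y => g y * tensor_kernel n x y)).
Proof.
move=> ig; apply: (@integrableMl _ _ _ mu T (@measurable_torus R d) (EFin \o g)
  (tensor_kernel n x) ig); last exact: tensor_kernel_bounded.
by apply: measurable_funTS; exact: measurable_tensor_kernel.
Qed.

Lemma conv_meanB n x (g h : d.-tuple R -> R) :
  mu.-integrable T (EFin \o g) -> mu.-integrable T (EFin \o h) ->
  conv_mean n (g \- h) x = conv_mean n g x - conv_mean n h x.
Proof.
move=> ig ih; rewrite /conv_mean.
rewrite -(RintegralB (@measurable_torus R d) (integrable_conv n x ig)
  (integrable_conv n x ih)).
by apply: eq_Rintegral => y _; rewrite mulrBl.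
Qed.

Lemma conv_meanZ n x c (g : d.-tuple R -> R) : mu.-integrable T (EFin \o g) ->
  conv_mean n (fun y => c * g y) x = c * conv_mean n g x.
Proof.
move=> ig; rewrite /conv_mean.
rewrite -(RintegralZl _ (@measurable_torus R d) (integrable_conv n x ig)).
by apply: eq_Rintegral => y _; rewrite mulrA.
Qed.

Lemma sum_geometric_le (q : R) L : 0 < q < 1 -> \sum_(k < L) q ^+ k <= (1 - q)^-1.
Proof.
move=> /andP[q0 q1]; have q10 : 0 < 1 - q by rewrite subr_gt0.
rewrite -[leRHS]mul1r ler_pdivlMr// mulrC.
have -> : (1 - q) * \sum_(k < L) q ^+ k = 1 - q ^+ L.
  have := subrXX 1 q L; rewrite expr1n => ->; congr (_ * _).
  by apply: eq_bigr => i _; rewrite expr1n mul1r.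
by rewrite gerBl exprn_ge0// ltW.
Qed.

Section weak_type.
Variables (tau delta : R).
Hypotheses (gamma1 : 1 <= gamma) (alpha0 : 0 < alpha) (tau1 : 1 <= tau).
Hypotheses (delta0 : 0 < delta) (d0 : (0 < d)%N).

Let inner := [set x : d.-tuple R | forall i, `|tnth x i| <= pi - delta].

(** Coordinatewise choice of the dyadic scale; the sum over all scales replaces the
one that is chosen, which depends on [x] and [y]. *)
Lemma tensor_kernel_dyadic : exists q C : R, [/\ 0 < q < 1, 0 < C &
  forall (n : d.-tuple nat), cone tau (map_tuple (fun m : nat => m%:R) n) ->
  exists N : nat, (0 < N)%N /\ forall x y, inner x -> T y ->
    `|tensor_kernel n x y| <=
    \sum_(k : {ffun 'I_d -> 'I_(N + 4)})
      (\prod_(i < d) (C * N%:R * (q ^+ 2 / 2) ^+ k i)) *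
      \1_(box (tnth x) (fun i => 2 ^+ k i / N%:R)) y].
Proof.
have [q [C [q01 C0 KD]]] := riesz_kernel_dyadic gamma1 alpha0 tau1 delta0.
exists q, C; split => // n [n0 ncone].
have {}n0 i : (0 < tnth n i)%N by have := n0 i; rewrite tnth_map ltr0n.
pose i0 := Ordinal d0; pose N := tnth n i0.
have N0 : (0 < N)%N by exact: n0.
exists N; split => // x y xi yT.
have nN i : (tnth n i)%:R <= tau * N%:R :> R.
  by have /andP[_] := ncone i i0; rewrite !tnth_map ler_pdivrMr// ltr0n.
have Nn i : N%:R <= tau * (tnth n i)%:R :> R.
  by have /andP[_] := ncone i0 i; rewrite !tnth_map ler_pdivrMr// ltr0n.
have txy i : `|tnth x i - tnth y i| <= 2 * pi - delta.
  apply: le_trans (ler_normB _ _) _.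
  by have := xi i; have := torus_le_pi i yT; lra.
have [k kP] := choice (fun i => KD N (tnth n i) _ N0 (n0 i) (nN i) (Nn i) (txy i)).
have kL i : (k i < N + 4)%N by have [] := kP i.
pose kappa := [ffun i => Ordinal (kL i)].
have rho0 : 0 <= q ^+ 2 / 2 by rewrite divr_ge0// exprn_ge0//; case/andP: q01 => /ltW.
rewrite (bigD1 kappa)//=; apply: ler_wpDr.
  apply: sumr_ge0 => l _; rewrite mulr_ge0// prodr_ge0// => i _.
  by rewrite mulr_ge0 ?exprn_ge0// mulr_ge0// ltW.
rewrite indicE mem_set; last first.
  by move=> i /=; rewrite ffunE/= distrC; have [] := kP i.
rewrite mulr1 normr_prod; apply: ler_prod => i _.
by rewrite normr_ge0 ffunE/=; have [] := kP i.
Qed.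

(** The exceptional set is the union over the shapes [2^k] of those of
[maximal_inequality] at the levels [lam' * q^-|k|].  Their measures are bounded by
multiples of [q^|k|], and off their union the term of index [k] in the kernel bound
contributes at most a multiple of [lam' * q^|k|]; both
families sum to products of geometric series. *)
Lemma conv_mean_weak_type : exists2 K : R, 0 < K &
  forall (g : d.-tuple R -> R) (lam : R), mu.-integrable T (EFin \o g) ->
  0 < lam -> exists Bad : set (d.-tuple R), [/\ measurable Bad,
    (mu Bad <= (K / lam)%:E * \int[mu]_(y in T) `|(g y)%:E|)%E &
    forall x, inner x -> ~ Bad x ->
    forall n : d.-tuple nat, cone tau (map_tuple (fun m : nat => m%:R) n) ->
      `|conv_mean n g x| <= lam].
Proof.
have [q [C [q01 C0 TK]]] := tensor_kernel_dyadic.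
have /andP[q0 q1] := q01.
have q10 : 0 < 1 - q by rewrite subr_gt0.
pose Q : R := (1 - q)^-1 ^+ d.
have Q0 : 0 < Q by rewrite exprn_gt0// invr_gt0.
exists (12 ^+ d * Q * (C ^+ d * Q)).
  by rewrite !mulr_gt0// exprn_gt0.
move=> g lam ig lam0.
pose F : d.-tuple R -> \bar R := (fun y => `|(g y)%:E|%E) \_ T.
have mg : measurable_fun T (fun y => `|(g y)%:E|%E).
  by apply: measurableT_comp => //; exact: measurable_int ig.
have mF : measurable_fun setT F.
  exact: (measurable_restrictT _ (@measurable_torus R d)).1.
have F0 y : (0 <= F y)%E by rewrite /F patchE; case: ifP.
have FE : (\int[mu]_y F y = \int[mu]_(y in T) `|(g y)%:E|)%E.
  by rewrite -integral_mkcond.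
set I := (\int[mu]_(y in T) _)%E in FE *.
have I0 : (0 <= I)%E by exact: integral_ge0.
(* The level is lowered by the constant that the summation over [k] costs. *)
pose lam' := lam / (C ^+ d * Q).
have lam'0 : 0 < lam' by rewrite divr_gt0// mulr_gt0// exprn_gt0.
pose lamk (k : {ffun 'I_d -> nat}) := lam' * \prod_(i < d) (q ^+ k i)^-1.
have lamk0 k : 0 < lamk k.
  by rewrite mulr_gt0// prodr_gt0// => i _; rewrite invr_gt0 exprn_gt0.
have [Bk BkP] := choice (fun k : {ffun 'I_d -> nat} =>
  @maximal_inequality R d F (fun i => 2 ^+ k i) (lamk k) mF F0
    (fun i => exprn_gt0 (k i) (ltr0Sn R 1)) (lamk0 k)).
have mBk k : measurable (Bk k) by have [] := BkP k.
pose ext L (k : {ffun 'I_d -> 'I_L}) : {ffun 'I_d -> nat} := [ffun i => k i : nat].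
pose E L := \big[setU/set0]_(k : {ffun 'I_d -> 'I_L}) Bk (ext L k).
have EP L x : E L x <-> exists k : {ffun 'I_d -> 'I_L}, Bk (ext L k) x.
  rewrite /E -bigcup_seq; split => [[k _ ?]|[k ?]]; exists k => //=.
  by rewrite mem_index_enum.
have mE L : measurable (E L) by apply: bigsetU_measurable => k _.
have geo L : \sum_(k : {ffun 'I_d -> 'I_L}) \prod_(i < d) q ^+ k i <= Q.
  rewrite -(bigA_distr_bigA (fun (i : 'I_d) (k : 'I_L) => q ^+ k))/=.
  rewrite prodr_const card_ord lerXn2r ?nnegrE ?invr_ge0 ?(ltW q10)//.
    by apply: sumr_ge0 => i _; rewrite exprn_ge0// ltW.
  exact: sum_geometric_le.
exists (\bigcup_L E L); split.
- exact: bigcup_measurable.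
- apply: measure_bigcup_ndseq_le => //.
    move=> L M LM; apply/subsetPset => x /EP[k Bkx]; apply/EP.
    exists [ffun i => widen_ord LM (k i)].
    by rewrite (_ : ext M _ = ext L k)//; apply/ffunP => i; rewrite !ffunE.
  move=> L.
  apply: (@le_trans _ _ (\sum_(k : {ffun 'I_d -> 'I_L})
      ((12 ^+ d / lam') * \prod_(i < d) q ^+ k i)%:E * I)%E).
    apply: le_trans (measure_bigsetU_le _ _ _) _ => //.
    apply: lee_sum => k _; have [_ + _] := BkP (ext L k); rewrite FE.
    suff -> : 12 ^+ d / lamk (ext L k) = 12 ^+ d / lam' * \prod_(i < d) q ^+ k i by [].
    rewrite /lamk invfM mulrA; congr (_ * _); rewrite prodfV invrK.
    by apply: eq_bigr => i _; rewrite ffunE.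
  rewrite -ge0_sume_distrl; last first.
    move=> k _; rewrite lee_fin mulr_ge0//; first by rewrite divr_ge0 ?exprn_ge0// ltW.
    by rewrite prodr_ge0// => i _; rewrite exprn_ge0// ltW.
  apply: lee_wpmul2r => //; rewrite sumEFin lee_fin -mulr_sumr.
  rewrite (_ : _ / lam = 12 ^+ d / lam' * Q); last first.
    rewrite /lam' invf_div; ring.
  by rewrite ler_wpM2l// divr_ge0 ?exprn_ge0// ltW.
move=> x xi xE n ncone.
have [N [N0 TKN]] := TK n ncone.
pose coef (k : {ffun 'I_d -> 'I_(N + 4)}) : R :=
  \prod_(i < d) (C * N%:R * (q ^+ 2 / 2) ^+ k i).
have coef0 k : 0 <= coef k.
  rewrite prodr_ge0// => i _; rewrite mulr_ge0 ?exprn_ge0 ?divr_ge0 ?exprn_ge0 ?(ltW q0)//.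
  by rewrite mulr_ge0// ltW.
pose bx (k : {ffun 'I_d -> 'I_(N + 4)}) := box (tnth x) (fun i => 2 ^+ k i / N%:R).
have mbx k : measurable (bx k) by exact: measurable_box.
have mFk k : measurable_fun setT (F \_ (bx k)).
  by apply/(measurable_restrictT _ (mbx k)); exact: measurable_funTS.
rewrite -lee_fin /conv_mean.
rewrite (EFin_normr_Rintegral (@measurable_torus R d) (integrable_conv n x ig)).
apply: le_trans (le_abse_integral _ (@measurable_torus R d) _) _.
  by apply: (measurable_int mu); exact: integrable_conv.
apply: (@le_trans _ _ (\int[mu]_y (\sum_(k : {ffun 'I_d -> 'I_(N + 4)})
    (coef k)%:E * (F \_ (bx k)) y))%E).
  rewrite integral_mkcond; apply: ge0_le_integral => //.
  - by move=> y _; apply: erestrict_ge0.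
  - apply/(measurable_restrictT _ (@measurable_torus R d)).
    apply: measurableT_comp => //.
    by apply: (measurable_int mu); exact: integrable_conv.
  - apply: emeasurable_sum => k; apply: measurable_funeM.
    exact: mFk.
  move=> y _; rewrite [leLHS]patchE; case: ifPn => yT; last first.
    apply: sume_ge0 => k _; rewrite mule_ge0// ?lee_fin//.
    by rewrite patchE; case: ifP.
  rewrite inE in yT.
  apply: (@le_trans _ _ (\sum_(k : {ffun 'I_d -> 'I_(N + 4)})
      (coef k * \1_(bx k) y * `|g y|)%:E)%E).
    rewrite sumEFin -mulr_suml lee_fin normrM mulrC ler_wpM2r//.
    exact: TKN.
  apply: lee_sum => k _; rewrite patchE /F patchE (mem_set yT) indicE.
  by case: ifP => _; rewrite ?mulr1 ?mulr0 ?mul0r ?mule0//.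
rewrite ge0_integral_sum//; last 2 first.
- move=> k; apply: measurable_funeM.
  exact: mFk.
- by move=> k y _; rewrite mule_ge0// ?lee_fin// patchE; case: ifP.
apply: (@le_trans _ _ (\sum_(k : {ffun 'I_d -> 'I_(N + 4)})
    (C ^+ d * lam' * \prod_(i < d) q ^+ k i)%:E)%E).
  apply: lee_sum => k _; rewrite ge0_integralZl//; last 2 first.
  - by move=> y _; rewrite patchE; case: ifP.
  - by rewrite lee_fin.
  rewrite -integral_mkcond.
  have xBk : ~ Bk (ext _ k) x.
    by move=> Bx; apply: xE; exists (N + 4)%N => //; apply/EP; exists k.
  have [_ _ /(_ x xBk N N0)] := BkP (ext _ k).
  have -> : (fun i => 2 ^+ ext _ k i / N%:R) = (fun i => 2 ^+ k i / N%:R) :> ('I_d -> R).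
    by apply/funext => i; rewrite ffunE.
  move=> H; apply: le_trans (lee_wpmul2l _ H) _; first by rewrite lee_fin.
  rewrite -EFinM lee_fin /lamk /coef.
  rewrite -[lam' * _ * _]mulrA mulrCA -!big_split/=.
  have -> : C ^+ d = \prod_(i < d) C by rewrite prodr_const card_ord.
  rewrite [\prod_(i < d) C * lam']mulrC -[leRHS]mulrA -big_split/=.
  rewrite ler_pM2l// le_eqVlt; apply/orP; left; apply/eqP; apply: eq_bigr => i _.
  rewrite ffunE expr_div_n exprAC expr2.
  have x0 : q ^+ k i != 0 by rewrite gt_eqF// exprn_gt0.
  have z0 : 2 ^+ k i != 0 :> R by rewrite gt_eqF// exprn_gt0.
  have N0' : N%:R != 0 :> R by rewrite pnatr_eq0 -lt0n.
  move: (q ^+ k i) (2 ^+ k i) (N%:R) x0 z0 N0' => u v w u0 v0 w0.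
  by field; rewrite u0 v0 w0.
rewrite sumEFin lee_fin -mulr_sumr.
apply: (@le_trans _ _ (C ^+ d * lam' * Q)).
  by rewrite ler_wpM2l// mulr_ge0 ?exprn_ge0// ltW.
by rewrite mulrAC mulrC divfK// gt_eqF// mulr_gt0// exprn_gt0.
Qed.

End weak_type.
End convolution_means.

(** * Functions summed almost everywhere and their closure in L_1 *)

Section negligible_criterion.
Context (disp : measure_display) (T : measurableType disp) (R : realType).
Variable mu : {measure set T -> \bar R}.
Local Open Scope ereal_scope.

Lemma negligible_arbitrarily_small (E : set T) (K : R) :
  (forall eps : R, (0 < eps)%R ->
    exists U, [/\ measurable U, E `<=` U & mu U <= (K * eps)%:E]) ->
  mu.-negligible E.
Proof.
move=> small.
have [U UP] := choice (fun k : nat => small k.+1%:R^-1%R (eqbRL (invr_gt0 _) (ltr0Sn R k))).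
have mU k : measurable (U k) by have [] := UP k.
exists (\bigcap_k U k); split.
- exact: bigcap_measurable.
- apply/eqP; rewrite -measure_le0; apply/lee_addgt0Pr => e e0; rewrite add0e.
  pose k := Num.truncn (`|K| / e).
  have [_ _ muU] := UP k.
  apply: le_trans (le_measure _ _ _ (bigcap_inf (i := k) _)) _; rewrite ?inE//.
    exact: bigcap_measurable.
  apply: le_trans muU _; rewrite lee_fin ler_pdivrMr ?ltr0n//.
  apply: le_trans (ler_norm _) _; rewrite mulrC -ler_pdivrMr//.
  exact/ltW/truncnS_gt.
- by move=> x Ex k _; have [_ + _] := UP k; apply.
Qed.

Lemma measurable_abs_ge (D : set T) (g : T -> R) (a : R) : measurable D ->
  measurable_fun D g -> measurable (D `&` [set x | (a <= `|g x|)%R]).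
Proof.
move=> mD mg; have -> : [set x | (a <= `|g x|)%R] =
    [set x | (a%:E <= `|(EFin \o g) x|)%E] by under [RHS]eq_set do rewrite lee_fin.
apply: emeasurable_fun_c_infty => //; apply: measurableT_comp => //.
exact/measurable_EFinP.
Qed.

Lemma markov_abs (D : set T) (g : T -> R) (a : R) : measurable D ->
  mu.-integrable D (EFin \o g) -> (0 < a)%R ->
  mu (D `&` [set x | (a <= `|g x|)%R]) <= a^-1%:E * \int[mu]_(x in D) `|(g x)%:E|.
Proof.
move=> mD ig a0.
have := @le_integral_comp_abse _ _ _ mu D mD (EFin \o g) a id (@measurable_id _ _ _)
  (fun r r0 => r0) (fun x y _ _ xy => xy) (measurable_int mu ig) a0.
rewrite muleC -lee_pdivlMr// muleC.
by under eq_set do rewrite lee_fin.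
Qed.

End negligible_criterion.

Section almost_everywhere_convergence.
Context (R : realType) (d : nat) (gamma alpha tau : R).
Hypotheses (gamma1 : 1 <= gamma) (alpha0 : 0 < alpha) (tau1 : 1 <= tau).
Hypothesis d0 : (0 < d)%N.
Local Notation T := (@torus R d).
Local Notation mu := (lebesgue_tuple R d).
Implicit Types g h : d.-tuple R -> R.

#[local] Instance cone_filter : ProperFilter (@cone_to_infty R d tau) :=
  cone_to_infty_filter d tau1.

(** The factor [(2 pi) ^ d] is the normalization of the Fourier coefficients. *)
Definition ae_summable g : Prop := {ae mu, forall x, T x ->
  conv_mean gamma alpha n g x @[n --> cone_to_infty tau] --> (2 * pi) ^+ d * g x}.

Lemma near_cone (P : set (d.-tuple nat)) :
  (forall n, cone tau (map_tuple (fun m : nat => m%:R : R) n) -> P n) ->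
  \forall n \near cone_to_infty tau, P n.
Proof. by move=> H; exists 0%N => n _; exact: H. Qed.

Let mT : measurable T := @measurable_torus R d.

Lemma ae_summableB g h : mu.-integrable T (EFin \o g) ->
  mu.-integrable T (EFin \o h) ->
  ae_summable g -> ae_summable h -> ae_summable (g \- h).
Proof.
move=> ig ih; apply: filterS2 => x gx hx Tx.
rewrite [X in X @ _](_ : _ = (fun n => conv_mean gamma alpha n g x)
  \- (fun n => conv_mean gamma alpha n h x)); last first.
  by apply/funext => n; rewrite conv_meanB.
by rewrite /= mulrBr; apply: cvgB; [exact: gx|exact: hx].
Qed.

Lemma ae_summableZ c g : mu.-integrable T (EFin \o g) ->
  ae_summable g -> ae_summable (fun y => c * g y).
Proof.
move=> ig; apply: filterS => x gx Tx.
rewrite [X in X @ _](_ : _ = (fun n => c * conv_mean gamma alpha n g x)); last first.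
  by apply/funext => n; rewrite conv_meanZ.
by rewrite /= mulrCA; apply: cvgMr; exact: gx.
Qed.

(** A pair of opposite faces is a product with one factor reduced to two points. *)
Lemma ae_torus_interior : {ae mu, forall x, T x -> forall i, `|tnth x i| != pi}.
Proof.
pose A (i j : 'I_d) : set R := if j == i then [set - pi; pi] else [set` `[- pi, pi]].
have mA i j : measurable (A i j).
  rewrite /A; case: ifP => _; last exact: measurable_itv.
  by apply: measurableU; exact: measurable_set1.
pose B (i : 'I_d) := [set t : d.-tuple R | forall j, A i j (tnth t j)].
apply: (@negligibleS _ _ _ _ (\big[setU/set0]_(i < d) B i)).
  move=> x /= /not_implyP[Tx /existsNP[i /negP/negPn/eqP xi]].
  rewrite -bigcup_seq; exists i => /=.
    by rewrite mem_index_enum.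
  move=> j; rewrite /A; case: eqP => [->|_]; last exact: Tx.
  by move: xi => /=; case: (ger0P (tnth x i)) => _ xi; [right|left; rewrite -xi opprK].
elim/big_rec: _ => [|i F _ nF]; first exact: negligible_set0.
apply: negligibleU => //; exists (B i); split => //.
  exact: (measurable_setn (mA i)).
apply: etrans (lebesgue_tuple_box (mA i)) _.
rewrite (bigD1 i)//= {1}/A eqxx.
rewrite (_ : lebesgue_measure _ = 0%E) ?mul0e//.
by apply: countable_lebesgue_measure0; apply: finite_set_countable; exact: finite_set2.
Qed.

(** Banach's principle: on the cube [|x_i| <= pi - 1/(j+1)], the points where the
oscillation around [g] exceeds [1/(m+1)] are, up to a null set, among those where
either the maximal function of [g - h] or [|g - h|] itself is large, and both sets
have measure at most a multiple of the distance from [g] to [h]. *)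
Lemma ae_summable_closed g : mu.-integrable T (EFin \o g) ->
  (forall eps : R, 0 < eps -> exists h, [/\ mu.-integrable T (EFin \o h),
    ae_summable h & (\int[mu]_(y in T) `|(g y - h y)%:E| <= eps%:E)%E]) ->
  ae_summable g.
Proof.
move=> ig approx.
pose c : R := (2 * pi) ^+ d.
have c0 : 0 < c by rewrite exprn_gt0// mulr_gt0// pi_gt0.
pose inn j := [set x : d.-tuple R | forall i, `|tnth x i| <= pi - j.+1%:R^-1].
pose close m x := \forall n \near cone_to_infty tau,
  `|conv_mean gamma alpha n g x - c * g x| <= m.+1%:R^-1.
have key m j : {ae mu, forall x, T x -> inn j x -> close m x}.
  have dl0 : 0 < j.+1%:R^-1 :> R by rewrite invr_gt0.
  pose eta : R := m.+1%:R^-1 / 3.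
  have eta0 : 0 < eta by rewrite divr_gt0// invr_gt0.
  have [K K0 weak] := conv_mean_weak_type gamma1 alpha0 tau1 dl0 d0.
  apply: (@negligible_arbitrarily_small _ _ _ _ _ (K / eta + c / eta)) => e e0.
  have [h [ih [N [mN N0 hN]] gh]] := approx e e0.
  have igh : mu.-integrable T (EFin \o (g \- h)).
    by rewrite (_ : _ \o _ = (EFin \o g) \- (EFin \o h))%E//; exact: integrableB.
  have [Bad [mBad muBad BadP]] := weak (g \- h) eta igh eta0.
  pose M := T `&` [set x | eta / c <= `|(g \- h) x|].
  have mM : measurable M.
    apply: measurable_abs_ge => //.
    by apply/measurable_EFinP; exact: (measurable_int mu igh).
  exists (N `|` (Bad `|` M)); split.
  - by apply: measurableU => //; exact: measurableU.
  - move=> x /= nclose; apply: contrapT => /not_orP[xN /not_orP[xBad xM]].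
    apply: nclose => Tx xin.
    have hx : (conv_mean gamma alpha n h x @[n --> cone_to_infty tau] --> c * h x).
      by apply: contrapT => nh; apply: xN; apply: hN => /(_ Tx).
    have gxh : c * `|g x - h x| <= eta.
      rewrite mulrC -ler_pdivlMr// leNgt; apply/negP => H; apply: xM; split => //=.
      exact: ltW.
    have S1 : \forall n \near cone_to_infty tau,
        `|conv_mean gamma alpha n (g \- h) x| <= eta.
      by apply: near_cone => n; exact: BadP.
    have S2 : \forall n \near cone_to_infty tau,
        `|conv_mean gamma alpha n h x - c * h x| <= eta.
      by move/cvgrPdist_le : hx => /(_ _ eta0); apply: filterS => n; rewrite distrC.
    apply: filterS2 S1 S2 => n; rewrite conv_meanB//.
    have -> : m.+1%:R^-1 = eta + eta + eta by rewrite /eta; field.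
    set a := conv_mean _ _ _ g x; set b := conv_mean _ _ _ h x => ab bh.
    have -> : a - c * g x = (a - b) + (b - c * h x) + c * (h x - g x) by ring.
    apply: le_trans (ler_normD _ _) _; apply: lerD.
      by apply: le_trans (ler_normD _ _) _; exact: lerD.
    by rewrite normrM gtr0_norm// distrC.
  apply: le_trans (measureU2 _ _ _) _ => //; first exact: measurableU.
  have N0' : (mu N <= 0)%E by move/eqP: N0; rewrite eq_le => /andP[].
  rewrite -[leRHS]add0e; apply: leeD => //.
  apply: le_trans (measureU2 _ _ _) _ => //.
  rewrite mulrDl EFinD; apply: leeD.
    apply: le_trans muBad _; rewrite [leRHS]EFinM; apply: lee_wpmul2l => //.
    by rewrite lee_fin divr_ge0// ltW.
  apply: le_trans (markov_abs mT igh _) _; first by rewrite divr_gt0.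
  rewrite [leRHS]EFinM invf_div; apply: lee_wpmul2l => //.
  by rewrite lee_fin divr_ge0// ltW.
have bd := ae_torus_interior.
have key2 : {ae mu, forall x, forall m j, T x -> inn j x -> close m x}.
  by apply/ae_foralln => m; apply/ae_foralln => j; exact: key.
apply: filterS2 bd key2 => x bx kx Tx.
have xpi i : 0 < pi - `|tnth x i|.
  by rewrite subr_gt0 lt_neqAle bx//= torus_le_pi.
have [j xj] : exists j, inn j x.
  have [J JP] := choice (fun i => ltr_add_invr (xpi i)).
  exists (\max_(i < d) J i)%N => i.
  rewrite lerBrDl -lerBrDr; apply/ltW/(le_lt_trans _ (JP i)).
  rewrite add0r lef_pV2 ?posrE// ler_nat ltnS.
  exact: (leq_bigmax (F := J) i).
apply/cvgrPdist_le => e e0.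
have [m me] := ltr_add_invr e0; rewrite add0r in me.
have := kx m j Tx xj; apply: filterS => n; rewrite distrC => /le_trans; apply.
exact: ltW.
Qed.

End almost_everywhere_convergence.

(** * Integrals of products of one-variable functions *)

Section integral_of_tensor.
Context (R : realType).
Local Open Scope ereal_scope.
Local Notation leb := (@lebesgue_measure R).

Lemma integral_tensor d (H : 'I_d -> R -> R) :
  (forall i, leb.-integrable setT (EFin \o H i)) ->
  (lebesgue_tuple R d).-integrable setT (fun t => (\prod_(i < d) H i (tnth t i))%:E)
  /\ \int[lebesgue_tuple R d]_t (\prod_(i < d) H i (tnth t i))%:E =
     (\prod_(i < d) \int[leb]_x H i x)%R%:E.
Proof.
elim: d H => [|d IH] H iH.
  have -> : (fun t : 0.-tuple R => (\prod_(i < 0) H i (tnth t i))%:E) = cst 1.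
    by apply/funext => t; rewrite big_ord0.
  have int1 : \int[lebesgue_tuple R 0]_(t in setT) (cst 1 t : \bar R) = 1.
    by rewrite integral_cst// mul1e /= diracT.
  split; last by rewrite big_ord0.
  apply/integrableP; split; first exact: measurable_cst.
  by rewrite (eq_integral (cst 1)) ?int1 ?ltry// => t _; rewrite /cst gee0_abs.
pose H' i := H (lift ord0 i).
have [iG GE] := IH H' (fun i => iH _).
set G := (fun t => _) in iG GE.
pose f (t : d.+1.-tuple R) := (\prod_(i < d.+1) H i (tnth t i))%:E.
have mH i : measurable_fun setT (H i).
  by apply/measurable_EFinP; exact: (measurable_int leb (iH i)).
have mf : measurable_fun setT f.
  apply/measurable_EFinP; apply: measurable_prod => i _.
  by apply: measurableT_comp => //; exact: measurable_tnth.
pose phi (p : measurableTypeR R * d.-tuple R) : d.+1.-tuple R := cons_pair p.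
have mphi : measurable_fun setT phi by exact: measurable_cons_pair.
pose P := (leb \x lebesgue_tuple R d)%E.
have fphi p : (f \o phi) p = (H ord0 p.1)%:E * G p.2.
  rewrite /f /phi/= big_ord_recl EFinM; congr (_%:E * _%:E).
  by apply: eq_bigr => i _; rewrite tnthS.
have mG : measurable_fun setT G by exact: (measurable_int (lebesgue_tuple R d) iG).
have mG' : measurable_fun setT (fun y => `|G y|) by exact: measurableT_comp.
have iP : P.-integrable setT (f \o phi).
  apply/integrable12ltyP; first exact: measurableT_comp.
  have -> : \int[leb]_x \int[lebesgue_tuple R d]_y `|(f \o phi) (x, y)| =
      \int[leb]_x (`|(H ord0 x)%:E| * \int[lebesgue_tuple R d]_y `|G y|).
    apply: eq_integral => x _.
    under eq_integral do rewrite fphi abseM/=.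
    by rewrite ge0_integralZl//; exact: mG'.
  have /integrableP[_ G1] := iG; have /integrableP[_ H1] := iH ord0.
  rewrite ge0_integralZr//; last 2 first.
  - apply: (@measurableT_comp _ _ _ _ _ _ abse _ (EFin \o H ord0)) => //.
    exact: (measurable_int leb (iH ord0)).
  - exact: integral_ge0.
  by rewrite lte_mul_pinfty// ?integral_ge0// ge0_fin_numE// integral_ge0.
have pushE (h : d.+1.-tuple R -> \bar R) :
    \int[lebesgue_tuple R d.+1]_t h t = \int[pushforward P phi]_t h t.
  exact: eq_measure_integral.
have iP' : P.-integrable (phi @^-1` setT) (f \o phi) by rewrite preimage_setT.
split.
  apply/integrableP; split => //; rewrite pushE.
  by have /integrableP[_] := integrable_pushforward mphi mf iP' measurableT.
rewrite pushE (integral_pushforward mphi mf iP' measurableT) preimage_setT.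
rewrite -integral12_prod_meas1//.
rewrite /fubini_F.
under eq_integral => x _.
  under eq_integral do rewrite fphi/=.
  rewrite integralZl//.
  rewrite GE.
  over.
rewrite integralZr//; last exact: (iH ord0).
rewrite big_ord_recl EFinM; congr (_ * _).
by rewrite /Rintegral fineK//; apply: integrable_fin_num => //; exact: (iH ord0).
Qed.

End integral_of_tensor.

(** * The integral of a cosine sum *)

Section cosine_integral.
Context (R : realType).
Implicit Types (w : nat -> R) (t x : R).

Definition cos_primitive w n t : R :=
  w 0%N * t + 2 * \sum_(k < n) w k.+1 / k.+1%:R * sin (k.+1%:R * t).

Lemma is_derive_cos_primitive w n t :
  is_derive t 1 (cos_primitive w n) (cos_kernel w n t).
Proof.
pose h (k : 'I_n) : R -> R := (w k.+1 / k.+1%:R) \*: (@sin R \o (k.+1%:R \*: id)).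
have -> : cos_primitive w n = (w 0%N \*: id) + 2 \*: \sum_(k < n) h k.
  by apply/funext => u; rewrite /cos_primitive !fctE fct_sumE.
apply: is_derive_eq; rewrite /cos_kernel /GRing.scale/= mulr1; congr (_ + _ * _).
apply: eq_bigr => k _; rewrite mulr1 mulrCA mulrA.
by rewrite -mulrA divfK ?pnatr_eq0// mulrC.
Qed.

Lemma cos_kernel_continuous w n : continuous (cos_kernel w n).
Proof.
move=> t; apply: cvgD; first exact: cvg_cst.
apply: cvgM; first exact: cvg_cst.
have sumc := @continuous_big R 'I_n +%R 0 xpredT add_continuous R
  (index_enum 'I_n) (fun k t => w k.+1 * cos (k.+1%:R * t)).
apply: sumc => k _ {}t.
apply: cvgM; first exact: cvg_cst.
apply: (@continuous_comp _ _ _ (fun t => k.+1%:R * t) (@cos R)).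
  by apply: cvgM; [exact: cvg_cst|exact: cvg_id].
exact: continuous_cos.
Qed.

(** Over a full period every nonconstant harmonic integrates to zero. *)
Lemma integral_cos_kernel w n x :
  (\int[@lebesgue_measure R]_(y in `[(- pi)%R, pi%R]) (cos_kernel w n (x - y))%:E =
   (2 * pi * w 0%N)%:E)%E.
Proof.
pose F y := - cos_primitive w n (x - y).
have dF (y : R) : is_derive y 1 F (cos_kernel w n (x - y)).
  have dx : is_derive y 1 (fun y : R => x - y) (- 1).
    have : is_derive y (1 : R) (cst x - id : R -> R) (0 - 1) by exact: is_deriveB.
    by rewrite sub0r.
  have dc := is_derive_cos_primitive w n (x - y).
  have := @is_derive1_comp R (cos_primitive w n) (fun y : R => x - y) y _ _ dc dx.
  move=> /is_deriveN; rewrite mulrN mulr1 opprK; exact.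
have cF : continuous F.
  by move=> y; apply: differentiable_continuous; apply/derivable1_diffP; exact: ex_derive.
have pi0 := pi_gt0 R.
rewrite (@continuous_FTC2 R _ F); first last.
- by move=> y _; rewrite derive1E; exact: derive_val.
- split.
  + by move=> y _; exact: ex_derive.
  + exact: cvg_at_right_filter (cF _).
  + exact: cvg_at_left_filter (cF _).
- apply: continuous_subspaceT => y.
  apply: (@continuous_comp _ _ _ (fun y => x - y) (cos_kernel w n)).
    by apply: cvgB; [exact: cvg_cst|exact: cvg_id].
  exact: cos_kernel_continuous.
- lra.
rewrite -EFinB; congr EFin; rewrite /F /cos_primitive.
have -> : \sum_(k < n) w k.+1 / k.+1%:R * sin (k.+1%:R * (x - - pi)) =
    \sum_(k < n) w k.+1 / k.+1%:R * sin (k.+1%:R * (x - pi)).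
  apply: eq_bigr => k _; congr (_ * _).
  have -> : k.+1%:R * (x - - pi) = k.+1%:R * (x - pi) + (pi *+ 2) *+ k.+1.
    by rewrite -[_ *+ k.+1]mulr_natl -[pi *+ 2]mulr_natl; ring.
  exact: (periodicn (@sinD2pi R)).
ring.
Qed.

End cosine_integral.

(** * One-dimensional convergence off the boundary *)

Section one_dimensional_limit.
Context (R : realType) (gamma alpha : R).
Hypotheses (gamma1 : 1 <= gamma) (alpha0 : 0 < alpha).
Local Notation leb := (@lebesgue_measure R).
Local Notation I := ([set` `[- pi, pi]] : set R).
Implicit Types (A : set R) (x : R).

(** Cut off to the period, so that the factors of a product are integrable on the
whole line as [integral_tensor] requires. *)
Definition window n A x : R -> R :=
  (fun y => \1_A y * riesz_kernel gamma alpha n (x - y)) \_ I.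

Let mI : measurable (I : set (measurableTypeR R)). Proof. exact: measurable_itv. Qed.

Let muI : leb I = (2 * pi)%:E.
Proof.
rewrite lebesgue_measure_itv/= lte_fin; have := pi_gt0 R => p0.
by rewrite ifT; [rewrite -EFinB; congr EFin; ring|lra].
Qed.

Let muIy : (leb I < +oo)%E. Proof. by rewrite muI ltry. Qed.

Lemma integrable_indic_kernel n A x : measurable A ->
  leb.-integrable I (EFin \o (fun y => \1_A y * riesz_kernel gamma alpha n (x - y))).
Proof.
move=> mA; apply: measurable_bounded_integrable => //.
- apply: measurable_funM; first exact: measurable_indic.
  apply: measurable_funTS.
  apply: (@measurableT_comp _ _ _ _ _ _ (riesz_kernel gamma alpha n)).
    exact: measurable_cos_kernel.
  by apply: measurable_funB; [exact: measurable_cst|exact: measurable_id].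
- apply: bounded_by => y _; rewrite normrM.
  apply: (@le_trans _ _ `|riesz_kernel gamma alpha n (x - y)|).
    by rewrite ler_piMl// indicE; case: (_ \in _); rewrite ?normr1 ?normr0.
  exact: cos_kernel_bounded.
Qed.

Lemma integrable_window n A x : measurable A ->
  leb.-integrable setT (EFin \o window n A x).
Proof.
move=> mA; rewrite /window -restrict_EFin.
exact: ((integrable_mkcond _ mI).1 (integrable_indic_kernel n x mA)).
Qed.

Definition window_integral n A x : R := \int[leb]_y window n A x y.

Lemma window_integralE n A x : window_integral n A x =
  \int[leb]_(y in I) (\1_A y * riesz_kernel gamma alpha n (x - y)).
Proof. by rewrite [RHS]Rintegral_mkcond. Qed.

Lemma window_integralC n A x : (0 < n)%N -> measurable A ->
  window_integral n A x = 2 * pi - window_integral n (~` A) x.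
Proof.
move=> n0 mA; rewrite /window_integral.
rewrite -(_ : \int[leb]_y window n setT x y = 2 * pi).
  rewrite -RintegralB//; try by apply: integrable_window => //; exact: measurableC.
  apply: eq_Rintegral => y _; rewrite /window !patchE; case: ifP => _; last first.
    by rewrite subr0.
  rewrite -mulrBl; congr (_ * _); rewrite !indicE in_setT in_setC.
  by case: (y \in A); rewrite /= ?subr0 ?subrr.
have := window_integralE n setT x; rewrite /window_integral => ->.
rewrite /Rintegral; under eq_integral do rewrite indicT mul1r.
by rewrite /riesz_kernel integral_cos_kernel riesz_profile0 ?mulr1.
Qed.

(** Away from the origin the kernel is bounded by a multiple of [n^-beta]. *)
Lemma window_integral_far A x (e : R) : measurable A -> `|x| < pi -> 0 < e ->
  (forall y, A y -> e <= `|x - y|) ->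
  window_integral n A x @[n --> \oo] --> 0.
Proof.
move=> mA xpi e0 Ae.
have [b [C [b0 C0 KD]]] := riesz_kernel_decay gamma1 alpha0.
have d0 : 0 < pi - `|x| by rewrite subr_gt0.
have [c c0 sc] := sin_ge_linear d0.
have p0 := pi_gt0 R.
pose M := C * (c * e) `^ (- (1 + b)) * (2 * pi).
have ce0 : 0 < c * e by rewrite mulr_gt0.
have M0 : 0 < M by rewrite mulr_gt0 ?mulr_gt0 ?powR_gt0.
have bound n : (0 < n)%N -> `|window_integral n A x| <= M * n%:R `^ (- b).
  move=> n0; have nr0 : 0 < n%:R :> R by rewrite ltr0n.
  rewrite window_integralE.
  have iW := integrable_indic_kernel n x mA.
  apply: le_trans (le_normr_Rintegral mI iW) _.
  pose B := C * (c * e) `^ (- (1 + b)) * n%:R `^ (- b).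
  rewrite (_ : M * _ = B * fine (leb I)); last by rewrite muI/= /M /B; ring.
  rewrite -Rintegral_cst//; apply: le_Rintegral => //.
  - by have := integrable_norm iW; apply: eq_integrable.
  - apply: measurable_bounded_integrable => //; exact: bounded_cst.
  move=> y yI; rewrite indicE; case: (boolP (y \in A)) => yA; last first.
    by rewrite mul0r normr0 /B !mulr_ge0 ?powR_ge0// ltW.
  rewrite inE in yA; rewrite mul1r.
  have xy : `|x - y| <= 2 * pi - (pi - `|x|).
    apply: le_trans (ler_normB _ _) _.
    have : `|y| <= pi by move: yI; rewrite /= in_itv/= ler_norml.
    by lra.
  have s0 : c * e <= `|sin ((x - y) / 2)|.
    apply: le_trans (sc _ xy); rewrite ler_wpM2l ?(ltW c0)//; exact: Ae.
  have sn0 : 0 < `|sin ((x - y) / 2)| by exact: lt_le_trans s0.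
  apply: le_trans (KD n _ n0 _) _; first by rewrite -normr_gt0.
  have b1 : 0 <= 1 + b by rewrite addr_ge0// ltW.
  apply: (@le_trans _ _ (C * n%:R * (n%:R * (c * e)) `^ (- (1 + b)))).
    rewrite ler_wpM2l ?mulr_ge0 ?(ltW C0)//.
    rewrite !powRN lef_pV2 ?posrE ?powR_gt0 ?mulr_gt0//.
    apply: ge0_ler_powR => //; [| |by rewrite ler_wpM2l].
      by rewrite nnegrE mulr_ge0// ltW.
    by rewrite nnegrE mulr_ge0.
  rewrite powRM ?(ltW ce0)// /B.
  have -> : n%:R `^ (- (1 + b)) = n%:R^-1 * n%:R `^ (- b).
    rewrite !powRN powRD; last by rewrite (gt_eqF nr0) implybT.
    by rewrite powRr1// invfM.
  rewrite le_eqVlt; apply/orP; left; apply/eqP.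
  have -> (a z u : R) : a * n%:R * (n%:R^-1 * z * u) = (n%:R^-1 * n%:R) * (a * u * z).
    by ring.
  by rewrite mulVf ?gt_eqF// mul1r.
apply/cvgrPdist_le => e' e'0.
near=> n.
rewrite sub0r normrN; apply: le_trans (bound n _) _; first by near: n; exact: nbhs_infty_gt.
have nr0 : 0 < n%:R :> R by rewrite ltr0n; near: n; exact: nbhs_infty_gt.
rewrite powRN ler_pdivrMr ?powR_gt0// -ler_pdivrMl// mulrC.
have M1 : 0 <= M / e' by rewrite divr_ge0// ltW.
have -> : M / e' = ((M / e') `^ b^-1) `^ b by rewrite -powRrM mulVf ?gt_eqF// powRr1.
apply: ge0_ler_powR; rewrite ?nnegrE ?powR_ge0 ?(ltW b0)//.
by near: n; exact: nbhs_infty_ger.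
Unshelve. all: by end_near. Qed.

Definition off_boundary A x : Prop := exists2 e : R, 0 < e &
  (forall y, `|x - y| < e -> A y) \/ (forall y, `|x - y| < e -> ~ A y).

(** If [A] contains a neighborhood of [x], pass to the complement: the total integral
of the kernel is exactly [2 pi]. *)
Lemma window_integral_cvg A x : measurable A -> `|x| < pi -> off_boundary A x ->
  window_integral n A x @[n --> \oo] --> 2 * pi * \1_A x.
Proof.
move=> mA xpi [e e0 [xA|xA]].
  have -> : 2 * pi * \1_A x = 2 * pi - 0 :> R.
    have Ax : A x by apply: xA; rewrite subrr normr0.
    by rewrite indicE (mem_set Ax) mulr1 subr0.
  have cC : 2 * pi - window_integral n (~` A) x @[n --> \oo] --> 2 * pi - 0.
    apply: cvgB; first exact: cvg_cst.
    apply: (window_integral_far (measurableC mA) xpi e0) => y nAy.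
    by rewrite leNgt; apply/negP => /xA.
  apply: cvg_trans cC; apply: near_eq_cvg; near=> n.
  rewrite [RHS]window_integralC//; near: n; exact: nbhs_infty_gt.
have -> : 2 * pi * \1_A x = 0 :> R.
  have Ax : ~ A x by apply: xA; rewrite subrr normr0.
  by rewrite indicE (memNset Ax) mulr0.
apply: (window_integral_far mA xpi e0) => y Ay.
by rewrite leNgt; apply/negP => /xA; exact.
Unshelve. all: by end_near. Qed.

End one_dimensional_limit.

(** * Products of sets on the line *)

Section tensor_sets.
Context (R : realType) (d : nat) (gamma alpha tau : R).
Hypotheses (gamma1 : 1 <= gamma) (alpha0 : 0 < alpha) (tau1 : 1 <= tau).
Hypothesis d0 : (0 < d)%N.
Local Notation T := (@torus R d).
Local Notation mu := (lebesgue_tuple R d).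
Local Notation leb := (@lebesgue_measure R).

#[local] Existing Instance cone_filter.

Definition tensor_set (A : 'I_d -> set R) : set (d.-tuple R) :=
  [set t | forall i, A i (tnth t i)].

Lemma conv_mean_tensor_set n A x : (forall i, measurable (A i)) ->
  conv_mean gamma alpha n \1_(tensor_set A) x =
  \prod_(i < d) window_integral gamma alpha (tnth n i) (A i) (tnth x i).
Proof.
move=> mA; rewrite /conv_mean Rintegral_mkcond.
have [_ /(congr1 fine) /= <-] := @integral_tensor R d
  (fun i => window gamma alpha (tnth n i) (A i) (tnth x i))
  (fun i => integrable_window gamma alpha (tnth n i) (tnth x i) (mA i)).
congr fine; apply: eq_integral => y _; congr EFin.
rewrite patchE; case: ifPn => [|/negP] yT.
  rewrite inE in yT.
  have -> : \1_(tensor_set A) y = \prod_(i < d) \1_(A i) (tnth y i) :> R.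
    rewrite indicE; case: (boolP (y \in tensor_set A)) => [|/negP] yA.
      rewrite inE in yA; rewrite big1// => i _.
      by rewrite indicE (mem_set (yA i)).
    have [i nAi] : exists i, ~ A i (tnth y i).
      by apply/existsNP => yA'; apply: yA; rewrite inE.
    by rewrite (bigD1 i)//= indicE (memNset nAi) mul0r.
  rewrite -big_split/=; apply: eq_bigr => i _.
  have yi : tnth y i \in ([set` `[- pi, pi]] : set R) by rewrite inE; exact: yT.
  by rewrite /window patchE yi.
have [i nTi] : exists i, ~ [set` `[- pi, pi]] (tnth y i).
  by apply/existsNP => yT'; apply: yT; rewrite inE.
by rewrite (bigD1 i)//= /window patchE (memNset nTi) mul0r.
Qed.

Lemma negligible_coordinate (N : set R) i : leb.-negligible N ->
  mu.-negligible [set t : d.-tuple R | N (tnth t i)].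
Proof.
move=> [M [mM M0 NM]]; pose A j := if j == i then M else setT.
have mA j : measurable (A j) by rewrite /A; case: ifP.
exists (tensor_set A); split.
- exact: measurable_setn.
- apply: etrans (lebesgue_tuple_box mA) _.
  (* The null factor annihilates the others, even when they have infinite measure. *)
  by rewrite (bigD1 i)//= {1}/A eqxx M0 mul0e.
- by move=> t /= Nt j; rewrite /A; case: eqP => [->|//]; exact: NM.
Qed.

Lemma cvg_tnth_cone i : tnth n i @[n --> @cone_to_infty R d tau] --> \oo.
Proof.
move=> P [N _ NP]; exists N => n nN _; apply: NP; exact: nN.
Qed.

(** Half-lines have this property, and it passes to intersections, as Dynkin's theorem
requires of a generating family. *)
Definition null_boundary (A : set R) :=
  measurable A /\ leb.-negligible [set x | ~ off_boundary A x].

Lemma null_boundaryT : null_boundary setT.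
Proof.
split=> //; rewrite (_ : mkset _ = set0); first exact: negligible_set0.
by apply/seteqP; split => // x; apply; exists 1 => //; left.
Qed.

Lemma null_boundaryI A B : null_boundary A -> null_boundary B ->
  null_boundary (A `&` B).
Proof.
move=> [mA nA] [mB nB]; split; first exact: measurableI.
apply: negligibleS (negligibleU nA nB) => x /= nAB; apply: contrapT.
move=> /not_orP[/contrapT[a a0 Ha] /contrapT[b b0 Hb]]; apply: nAB.
exists (Num.min a b); first by rewrite lt_min a0.
have lta y : `|x - y| < Num.min a b -> `|x - y| < a by rewrite lt_min => /andP[].
have ltb y : `|x - y| < Num.min a b -> `|x - y| < b by rewrite lt_min => /andP[].
case: Ha => Ha; last by right => y /lta /Ha nAy [].
case: Hb => Hb; last by right => y /ltb /Hb nBy [].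
by left => y xy; split; [exact/Ha/lta|exact/Hb/ltb].
Qed.

Lemma null_boundary_ray a : null_boundary `]a, +oo[%classic.
Proof.
split; first exact: measurable_itv.
exists [set a]; split; [exact: measurable_set1|exact: lebesgue_measure_set1|].
move=> x /= nx; apply: contrapT => /eqP xa; apply: nx.
exists `|x - a|; first by rewrite normr_gt0 subr_eq0.
have [ax|xa'] := ltP a x; [left|right] => y; rewrite /= in_itv/= andbT.
  by rewrite (@gtr0_norm _ (x - a)) ?subr_gt0// ltr_norml => /andP[_]; lra.
rewrite (@ler0_norm _ (x - a)) ?subr_le0// ltr_norml => /andP[+ _].
by rewrite opprK => ?; apply/negP; rewrite -leNgt; lra.
Qed.

Lemma ae_summable_tensor_set A : (forall i, null_boundary (A i)) ->
  ae_summable gamma alpha tau (\1_(tensor_set A) : d.-tuple R -> R).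
Proof.
move=> nbA; have mA i : measurable (A i) by case: (nbA i).
have bd := @ae_torus_interior R d.
have off : {ae mu, forall x, forall i, off_boundary (A i) (tnth x i)}.
  apply: (@negligibleS _ _ _ _ (\big[setU/set0]_(i < d)
      [set x : d.-tuple R | ~ off_boundary (A i) (tnth x i)])).
    move=> x /= /existsNP[i nxi]; rewrite -bigcup_seq; exists i => //=.
    by rewrite mem_index_enum.
  elim/big_rec: _ => [|i F _ nF]; first exact: negligible_set0.
  apply: negligibleU => //.
  by apply: (@negligible_coordinate [set x | ~ off_boundary (A i) x]); case: (nbA i).
apply: filterS2 bd off => x bx ox Tx.
under eq_fun do rewrite conv_mean_tensor_set//.
have -> : (2 * pi) ^+ d * \1_(tensor_set A) x =
    \prod_(i < d) (2 * pi * \1_(A i) (tnth x i)) :> R.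
  rewrite big_split/= prodr_const card_ord; congr (_ * _).
  rewrite indicE; case: (boolP (x \in tensor_set A)) => [|/negP] xA.
    rewrite inE in xA; rewrite big1// => i _.
    by rewrite indicE (mem_set (xA i)).
  have [i nAi] : exists i, ~ A i (tnth x i).
    by apply/existsNP => xA'; apply: xA; rewrite inE.
  by rewrite (bigD1 i)//= indicE (memNset nAi) mul0r.
apply: cvg_big => [|i _]; first exact: mul_continuous.
apply: (@cvg_comp _ _ _ (fun n : d.-tuple nat => tnth n i)
  (fun m => window_integral gamma alpha m (A i) (tnth x i)) _ \oo).
  exact: cvg_tnth_cone.
apply: window_integral_cvg => //.
by rewrite lt_neqAle bx// torus_le_pi.
Qed.

Definition null_boundary_products : set (set (d.-tuple R)) :=
  [set B | exists2 A, (forall i, null_boundary (A i)) & B = tensor_set A].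

(** Restricting one coordinate to an open half-line gives such a product, and the
half-lines generate the Borel sets. *)
Lemma measurable_null_boundary_products (B : set (d.-tuple R)) :
  measurable B -> <<s null_boundary_products >> B.
Proof.
apply: smallest_sub; first exact: smallest_sigma_algebra.
rewrite -bigcup_seq => X [i /= _ [U mU <-]]; rewrite setTI.
have sA := @sigma_algebra_image _ _ setT (fun t : d.-tuple R => tnth t i) _
  (smallest_sigma_algebra setT null_boundary_products).
have : image_set_system setT (fun t : d.-tuple R => tnth t i)
    <<s null_boundary_products >> U.
  have : (@RGenOInfty.G R).-sigma.-measurable U by rewrite -RGenOInfty.measurableE; exact: mU.
  apply: smallest_sub => //.
  move=> V [a ->]; rewrite /image_set_system/= setTI; apply: sub_sigma_algebra.
  exists (fun j => if j == i then `]a, +oo[%classic else setT).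
    by move=> j; case: ifP => _; [exact: null_boundary_ray|exact: null_boundaryT].
  apply/seteqP; split => t /= ta.
    by move=> j; case: eqP => // ->.
  by have := ta i; rewrite eqxx.
by rewrite /image_set_system/= setTI.
Qed.

Lemma setI_closed_null_boundary_products : setI_closed null_boundary_products.
Proof.
move=> _ _ [A nA ->] [B nB ->]; exists (fun i => A i `&` B i).
  by move=> i; exact: null_boundaryI.
by apply/seteqP; split => t /= => [[tA tB] i|tAB]; [|split => i; have [] := tAB i].
Qed.

End tensor_sets.

(** * From product sets to integrable functions *)

Section all_integrable_functions.
Context (R : realType) (d : nat) (gamma alpha tau : R).
Hypotheses (gamma1 : 1 <= gamma) (alpha0 : 0 < alpha) (tau1 : 1 <= tau).
Hypothesis d0 : (0 < d)%N.
Local Notation T := (@torus R d).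
Local Notation mu := (lebesgue_tuple R d).
Local Notation summable := (@ae_summable R d gamma alpha tau).
Implicit Types A B : set (d.-tuple R).

Let mT : measurable T := @measurable_torus R d.

Lemma integrable_indic_torus A : measurable A ->
  mu.-integrable T (EFin \o (\1_A : d.-tuple R -> R)).
Proof.
move=> mA; apply: measurable_bounded_integrable => //.
- exact: lebesgue_torus_lty.
- apply: (@bounded_by _ _ _ _ 1) => x _.
  by rewrite indicE; case: (_ \in _); rewrite ?normr1 ?normr0.
Qed.

(** The differences shrink to the empty set inside a set of finite measure, so the
indicators converge in [L_1]. *)
Lemma ae_summable_bigcup (F : (set (d.-tuple R))^nat) : nondecreasing_seq F ->
  (forall n, measurable (F n) /\ summable \1_(F n)) -> summable \1_(\bigcup_n F n).
Proof.
move=> ndF FP; have mF n : measurable (F n) by case: (FP n).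
have mU : measurable (\bigcup_n F n) by exact: bigcup_measurable.
apply: ae_summable_closed => //; first exact: integrable_indic_torus.
move=> e e0.
pose D n := (\bigcup_n F n `\` F n) `&` T.
have mD n : measurable (D n) by apply: measurableI => //; exact: measurableD.
have D0 : \bigcap_n D n = set0.
  apply/seteqP; split => // x Dx.
  have [[[n _ Fnx] _] _] := Dx 0%N Logic.I.
  by have [[_]] := Dx n Logic.I.
have cD : mu (D n) @[n --> \oo] --> 0%E.
  rewrite -(measure0 mu) -D0; apply: nonincreasing_cvg_mu => //.
  - apply: le_lt_trans (lebesgue_torus_lty R d).
    by apply: le_measure; rewrite ?inE//; exact: subIsetr.
  - by rewrite D0.
  - move=> n m nm; apply/subsetPset => x [[Ux nFx] Tx]; split => //; split => //.
    by move=> Fnx; apply: nFx; move: x Fnx {Ux Tx}; exact/subsetPset/ndF.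
have [n Dn] : exists n, (mu (D n) <= e%:E)%E.
  have /fine_cvgP[_ /cvgrPdist_le /(_ _ e0) [n _ /(_ n (leqnn n))]] := cD.
  rewrite /= sub0r normrN => /(le_trans (ler_norm _)) De.
  exists n; rewrite -[leLHS]fineK ?lee_fin// ge0_fin_numE//.
  apply: le_lt_trans (lebesgue_torus_lty R d).
  by apply: le_measure; rewrite ?inE//; exact: subIsetr.
exists \1_(F n); split; [exact: integrable_indic_torus|by case: (FP n)|].
apply: le_trans Dn; rewrite /D -integral_indic//; last exact: measurableD.
rewrite le_eqVlt; apply/orP; left; apply/eqP; apply: eq_integral => x _.
rewrite abse_EFin; congr EFin; rewrite !indicE in_setD.
case: (boolP (x \in F n)) => xF /=; last first.
  by rewrite subr0 andbT; case: (_ \in _); rewrite ?normr1 ?normr0.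
have -> : x \in \bigcup_n F n by rewrite inE; exists n => //; rewrite inE in xF.
by rewrite subrr normr0.
Qed.

(** Dynkin's theorem for the intersection-stable family of products. *)
Lemma ae_summable_indic A : measurable A -> summable \1_A.
Proof.
move=> mA.
pose H := [set B | measurable B /\ summable \1_B].
suff : H A by case.
have := measurable_null_boundary_products mA; apply: lambda_system_subset => //.
- exact: setI_closed_null_boundary_products.
- split => //.
  + split; first exact: measurableT.
    rewrite (_ : setT = tensor_set (fun=> setT)); last by apply/seteqP; split.
    by apply: ae_summable_tensor_set => // i; exact: null_boundaryT.
  + move=> B C CB [mB sB] [mC sC]; split; first exact: measurableD.
    rewrite (_ : \1_(B `\` C) = (\1_B \- \1_C : d.-tuple R -> R)).
      by apply: ae_summableB => //; exact: integrable_indic_torus.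
    apply/funext => x; rewrite /= !indicE in_setD.
    case: (boolP (x \in C)) => xC /=; last by rewrite subr0 andbT.
    have -> : x \in B by rewrite inE; apply: CB; rewrite inE in xC.
    by rewrite subrr.
  + move=> F ndF FP; split; first by apply: bigcup_measurable => n _; case: (FP n).
    exact: ae_summable_bigcup.
- move=> _ [B nB ->]; split; last exact: ae_summable_tensor_set.
  by apply: measurable_setn => i; case: (nB i).
Qed.

Import HBSimple.

Lemma ae_summable_sfun (g : {sfun (d.-tuple R) >-> R}) : summable g.
Proof.
rewrite (_ : (g : _ -> R) = (fun x => \sum_(y \in range g) y * \1_(g @^-1` [set y]) x)).
  rewrite (_ : (fun x => _) =
      (fun x => \sum_(y <- finmap.enum_fset (fset_set (range g)))
        y * \1_(g @^-1` [set y]) x)); last first.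
    by apply/funext => x; rewrite fsbig_finite.
  have mg y : measurable (g @^-1` [set y]) by [].
  suff : forall s : seq R, mu.-integrable T
      (EFin \o (fun x => \sum_(y <- s) y * \1_(g @^-1` [set y]) x)) /\
    summable (fun x => \sum_(y <- s) y * \1_(g @^-1` [set y]) x).
    by move=> /(_ (finmap.enum_fset (fset_set (range g))))[].
  elim=> [|y s [isum ss]].
    rewrite (_ : (fun x => _) = (fun x => 0 * \1_set0 x : R)); last first.
      by apply/funext => x; rewrite big_nil mul0r.
    have i0 := integrable_indic_torus (@measurable0 _ (d.-tuple R)).
    split; last by apply: ae_summableZ => //; exact: ae_summable_indic.
    by have := integrableZl mT 0 i0.
  have iy : mu.-integrable T (EFin \o (fun x => y * \1_(g @^-1` [set y]) x)).
    by have := integrableZl mT y (integrable_indic_torus (mg y)).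
  have isum' : mu.-integrable T (EFin \o (fun x => -1 *
      (\sum_(y <- s) y * \1_(g @^-1` [set y]) x))).
    by have := integrableZl mT (-1) isum.
  rewrite (_ : (fun x => _) = (fun x => y * \1_(g @^-1` [set y]) x) \-
      (fun x => -1 * \sum_(y <- s) y * \1_(g @^-1` [set y]) x)); last first.
    by apply/funext => x; rewrite big_cons /= mulN1r opprK.
  split; first exact: (integrableB mT iy isum').
  apply: ae_summableB => //; apply: ae_summableZ => //.
    exact: integrable_indic_torus.
  exact: ae_summable_indic.
by apply/funext => x; exact: fimfunE.
Qed.

Lemma ae_summable_integrable (g : d.-tuple R -> R) :
  mu.-integrable T (EFin \o g) -> summable g.
Proof.
move=> ig; apply: ae_summable_closed => // e e0.
have [h_ [ih _ ch]] := approximation_sfun_integrable mT ig.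
have /fine_cvgP[fin /cvgrPdist_le /(_ _ e0) ch'] := ch.
have [n [finn chn]] : exists n,
   (\int[mu]_(z in T) `|(EFin \o g) z - (h_ n z)%:E|)%E \is a fin_num
   /\ `|0 - fine (\int[mu]_(z in T) `|(EFin \o g) z - (h_ n z)%:E|)%E| <= e.
  have [n _ Hn] := filterI fin ch'.
  by exists n; have [? ?] := Hn n (leqnn n).
exists (h_ n); split => //; first exact: ae_summable_sfun.
rewrite -(fineK finn) lee_fin; apply: le_trans chn.
by rewrite sub0r normrN ler_norm.
Qed.

End all_integrable_functions.

(** * Riesz means as convolutions *)

Section exponential_sums.
Context (R : realType).
Local Open Scope complex_scope.
Implicit Types (t : R).

Lemma expiD (s t : R) : expi (s + t) = expi s * expi t.
Proof.
by apply/eqP; rewrite eq_complex /= cosD sinD; apply/andP; split; apply/eqP; ring.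
Qed.

Lemma expi0 : expi (0 : R) = 1.
Proof. by rewrite /expi cos0 sin0. Qed.

Lemma expi_sum (I : finType) (F : I -> R) :
  expi (\sum_i F i) = \prod_i expi (F i).
Proof. exact: (big_morph _ expiD expi0). Qed.

Lemma expi_real t : expi t + expi (- t) = (2 * cos t)%:C.
Proof.
by apply/eqP; rewrite eq_complex /= cosN sinN; apply/andP; split; apply/eqP; ring.
Qed.

(** The shift by [M] centers the indices at [0]; opposite frequencies are paired. *)
Lemma sum_expi_cos_kernel (w : nat -> R) (n M : nat) t : (n <= M)%N ->
  \sum_(j < (M + M).+1 | (`|j%:Z - M%:Z| <= n)%N)
    (w `|j%:Z - M%:Z|%N)%:C * expi ((j%:Z - M%:Z)%:~R * t) =
  (cos_kernel w n t)%:C.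
Proof.
move=> nM.
pose G (z : int) : R[i] :=
  if (`|z| <= n)%N then (w `|z|%N)%:C * expi (z%:~R * t) else 0.
rewrite big_mkcond/= (eq_bigr (fun j : 'I_(M + M).+1 => G (j%:Z - M%:Z)))//.
rewrite -(big_mkord xpredT (fun j : nat => G (j%:Z - M%:Z))).
rewrite (big_cat_nat (n := M))//=; last by rewrite leqW// leq_addr.
have -> : \sum_(M <= j < (M + M).+1) G (j%:Z - M%:Z) =
    G 0 + \sum_(0 <= k < M) G k.+1%:Z.
  rewrite -[X in \sum_(X <= _ < _) _]add0n big_addn -addSn addnK big_nat_recl//.
  by congr (G _ + _); [lia|apply: eq_bigr => k _; congr G; lia].
rewrite big_nat_rev/= addrCA -big_split/=.
rewrite {1}/G /= mul0r expi0 mulr1.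
rewrite /cos_kernel rmorphD; congr (_ + _).
rewrite big_mkord rmorphM rmorph_sum/= mulr_sumr.
rewrite (big_ord_widen _ (fun k => 2%:C * (w k.+1 * cos (k.+1%:R * t))%:C) nM).
rewrite [RHS]big_mkcond/=; apply: eq_bigr => k _.
have E1 : (0 + M - k.+1)%N%:Z - M%:Z = - (k.+1%:Z) by have := ltn_ord k; lia.
rewrite E1 /G abszN absz_nat; case: ifP => kn; last by rewrite addr0.
rewrite -mulrDr mulrNz mulNr addrC expi_real -!rmorphM/=.
by congr (_%:C); ring.
Qed.

(** Frequencies shifted by [M] to be indexed by a finite type, the form in which a
product of sums can be expanded. *)
Lemma sum_frequencies (V : nmodType) d (n : d.-tuple nat)
    (F : d.-tuple int -> V) (M := (\max_(i < d) tnth n i)%N)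
    (h := fun f : {ffun 'I_d -> 'I_(M + M).+1} =>
       [tuple ((f i : nat)%:Z - M%:Z)%R | i < d]) :
  \sum_(k \in frequencies n) F k =
  \sum_(f in family (fun i => [pred j : 'I_(M + M).+1 |
    (`|j%:Z - M%:Z| <= tnth n i)%N])) F (h f).
Proof.
set P := family _.
rewrite (@bigfs _ _ _ _ (index_enum _) (fun f => f \in P)) ?index_enum_uniq//;
  last by move=> f _; rewrite mem_index_enum.
have shift (z : int) : (`|z| <= M)%N ->
    (absz (z + M%:Z)%R < (M + M).+1)%N /\ (absz (z + M%:Z))%:Z - M%:Z = z by lia.
have kM (k : d.-tuple int) : frequencies n k -> forall i, (`|tnth k i| <= M)%N.
  by move=> kn i; apply: leq_trans (kn i) _; exact: (leq_bigmax i).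
apply: reindex_fsbig; split.
- move=> f /= /familyP fP i; rewrite tnth_mktuple; exact: fP.
- move=> f g _ _ fg; apply/ffunP => i; apply/val_inj => /=.
  by have := congr1 (fun z => tnth z i) fg; rewrite !tnth_mktuple; lia.
- move=> k kn /=; exists [ffun i => inord (absz (tnth k i + M%:Z))].
    apply/familyP => i; rewrite ffunE inE/=.
    have [lt E] := shift _ (kM k kn i).
    by rewrite inordK// E; exact: kn.
  apply: eq_from_tnth => i; rewrite tnth_mktuple ffunE.
  by have [lt E] := shift _ (kM k kn i); rewrite inordK.
Qed.

Lemma sum_frequencies_tensor (gamma alpha : R) d (n : d.-tuple nat) (x y : d.-tuple R) :
  \sum_(k \in frequencies n)
    (riesz_weight gamma alpha n k)%:C * expi (dot k x - dot k y) =
  (tensor_kernel gamma alpha n x y)%:C.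
Proof.
rewrite sum_frequencies; set M := (\max_(i < d) tnth n i)%N.
rewrite /tensor_kernel rmorph_prod/=.
transitivity (\prod_(i < d) \sum_(j < (M + M).+1 | (`|j%:Z - M%:Z| <= tnth n i)%N)
    (riesz_profile gamma alpha (tnth n i) `|j%:Z - M%:Z|%N)%:C *
    expi ((j%:Z - M%:Z)%:~R * (tnth x i - tnth y i))); last first.
  apply: eq_bigr => i _; apply: sum_expi_cos_kernel; exact: (leq_bigmax i).
rewrite (bigA_distr_big_dep _ (fun i (j : 'I_(M + M).+1) =>
    (riesz_profile gamma alpha (tnth n i) `|j%:Z - M%:Z|%N)%:C *
    expi ((j%:Z - M%:Z)%:~R * (tnth x i - tnth y i))))/=.
apply: eq_bigr => f _.
pose a i := riesz_profile gamma alpha (tnth n i) `|(f i)%:Z - M%:Z|%N.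
pose b i : R := ((f i)%:Z - M%:Z)%:~R * (tnth x i - tnth y i).
rewrite [X in X%:C * _](_ : _ = \prod_(i < d) a i); last first.
  by apply: eq_bigr => i _; rewrite tnth_mktuple.
rewrite [X in _ * expi X](_ : _ = \sum_(i < d) b i); last first.
  by rewrite /dot -sumrB; apply: eq_bigr => i _; rewrite /b tnth_mktuple mulrBr.
rewrite rmorph_prod.
rewrite (expi_sum b).
rewrite -big_split.
by apply: eq_bigr => i _.
Qed.

End exponential_sums.

Section complex_integrals.
Context (R : realType) (d : nat).
Local Open Scope complex_scope.
Local Notation T := (@torus R d).
Local Notation mu := (lebesgue_tuple R d).
Implicit Types u v : d.-tuple R -> R[i].

Let mT : measurable T := @measurable_torus R d.

Definition cintegrable u : Prop :=
  mu.-integrable T (EFin \o (fun y => complex.Re (u y))) /\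
  mu.-integrable T (EFin \o (fun y => complex.Im (u y))).

Lemma integral_torus_ext u v : u =1 v -> integral_torus u = integral_torus v.
Proof. by move=> uv; congr integral_torus; exact/funext. Qed.

Lemma cintegrableD u v : cintegrable u -> cintegrable v ->
  cintegrable (fun y => u y + v y).
Proof.
move=> [u1 u2] [v1 v2]; split.
  have := integrableD mT u1 v1.
  by apply: eq_integrable => // y _ /=; case: (u y) (v y) => ? ? [].
have := integrableD mT u2 v2.
by apply: eq_integrable => // y _ /=; case: (u y) (v y) => ? ? [].
Qed.

Lemma integral_torusD u v : cintegrable u -> cintegrable v ->
  integral_torus (fun y => u y + v y) = integral_torus u + integral_torus v.
Proof.
move=> [u1 u2] [v1 v2]; rewrite /integral_torus; simpc.
by congr (_ +i* _); rewrite -RintegralD//; apply: eq_Rintegral => y _;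
  case: (u y) (v y) => ? ? [].
Qed.

Lemma cintegrableZ (z : R[i]) u : cintegrable u -> cintegrable (fun y => z * u y).
Proof.
case: z => a b [u1 u2]; split.
  have := integrableB mT (integrableZl mT a u1) (integrableZl mT b u2).
  by apply: eq_integrable => // y _ /=; case: (u y).
have := integrableD mT (integrableZl mT a u2) (integrableZl mT b u1).
by apply: eq_integrable => // y _ /=; case: (u y).
Qed.

Lemma integral_torusZ (z : R[i]) u : cintegrable u ->
  integral_torus (fun y => z * u y) = z * integral_torus u.
Proof.
case: z => a b [u1 u2]; rewrite /integral_torus; simpc.
have ia1 := integrableZl mT a u1; have ib1 := integrableZl mT b u1.
have ia2 := integrableZl mT a u2; have ib2 := integrableZl mT b u2.
congr (_ +i* _).
  rewrite -!RintegralZl// -RintegralB//.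
  by apply: eq_Rintegral => y _; case: (u y).
rewrite -!RintegralZl// -RintegralD//.
by apply: eq_Rintegral => y _; case: (u y).
Qed.

Lemma cintegrable_sum (I : Type) (s : seq I) (u : I -> d.-tuple R -> R[i]) :
  (forall i, cintegrable (u i)) ->
  cintegrable (fun y => \sum_(i <- s) u i y) /\
  integral_torus (fun y => \sum_(i <- s) u i y) = \sum_(i <- s) integral_torus (u i).
Proof.
move=> iu; elim: s => [|i s [IH1 IH2]].
  have i0 : cintegrable (fun=> 0).
    by split; exact: integrable0.
  rewrite big_nil; under eq_fun do rewrite big_nil.
  split => //; rewrite /integral_torus/= /Rintegral !integral0//.
rewrite big_cons; under eq_fun do rewrite big_cons.
by split; [exact: cintegrableD|rewrite integral_torusD// IH2].
Qed.

Lemma measurable_dot k : measurable_fun setT (@dot R d k).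
Proof.
apply: measurable_sum => i; apply: measurable_funM; first exact: measurable_cst.
exact: measurable_tnth.
Qed.

Lemma cintegrableM_expi u k : cintegrable u ->
  cintegrable (fun y => u y * expi (- dot k y)).
Proof.
move=> [u1 u2].
have mk : measurable_fun T (fun y => - dot k y).
  by apply: measurable_funTS; apply: measurableT_comp => //; exact: measurable_dot.
have mc : measurable_fun T (fun y => cos (- dot k y)).
  apply: (@measurableT_comp _ _ _ _ _ _ (@cos R)) => //.
  by apply: continuous_measurable_fun; exact: continuous_cos.
have ms : measurable_fun T (fun y => sin (- dot k y)).
  apply: (@measurableT_comp _ _ _ _ _ _ (@sin R)) => //.
  by apply: continuous_measurable_fun; exact: continuous_sin.
have bc : [bounded cos (- dot k y) | y in T].
  by apply: (@bounded_by _ _ _ _ 1) => y _; rewrite ler_norml cos_geN1 cos_le1.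
have bs : [bounded sin (- dot k y) | y in T].
  by apply: (@bounded_by _ _ _ _ 1) => y _; rewrite ler_norml sin_geN1 sin_le1.
split.
  have := integrableB mT (integrableMl mT u1 mc bc) (integrableMl mT u2 ms bs).
  by apply: eq_integrable => // y _ /=; case: (u y).
have := integrableD mT (integrableMl mT u1 ms bs) (integrableMl mT u2 mc bc).
by apply: eq_integrable => // y _ /=; case: (u y).
Qed.

Lemma L1_torus_cintegrable (f : d.-tuple R -> R[i]) : L1_torus f -> cintegrable f.
Proof.
move=> [mRe mIm fin].
have mN : measurable_fun T (fun x => (Normc.normc (f x))%:E).
  apply/measurable_EFinP.
  rewrite (_ : (fun x => _) = (fun x => Num.sqrt
      (complex.Re (f x) ^+ 2 + complex.Im (f x) ^+ 2))); last first.
    by apply/funext => x; case: (f x).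
  apply: (@measurableT_comp _ _ _ _ _ _ (@Num.sqrt R)).
    by apply: continuous_measurable_fun; exact: sqrt_continuous.
  by apply: measurable_funD; exact: measurable_funX.
split; apply/integrableP; (split; first exact/measurable_EFinP).
  apply: le_lt_trans fin; apply: ge0_le_integral => //.
  - by apply: measurableT_comp => //; exact/measurable_EFinP.
  - move=> x _; rewrite /= lee_fin; case: (f x) => a b /=.
    by rewrite -[leLHS]sqrtr_sqr ler_sqrt ?addr_ge0 ?sqr_ge0// lerDl sqr_ge0.
apply: le_lt_trans fin; apply: ge0_le_integral => //.
- by apply: measurableT_comp => //; exact/measurable_EFinP.
- move=> x _; rewrite /= lee_fin; case: (f x) => a b /=.
  by rewrite -[leLHS]sqrtr_sqr ler_sqrt ?addr_ge0 ?sqr_ge0// lerDr sqr_ge0.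
Qed.

(** The kernel is real because the weights are even in each frequency, so the means
act separately on the real and imaginary parts. *)
Lemma riesz_mean_conv_mean (gamma alpha : R) n f x : cintegrable f ->
  riesz_mean gamma alpha n f x = ((2 * pi) ^- d)%:C *
    (conv_mean gamma alpha n (fun y => complex.Re (f y)) x +i*
     conv_mean gamma alpha n (fun y => complex.Im (f y)) x).
Proof.
move=> fi; rewrite /riesz_mean; set c := _%:C.
pose u k := fun y => ((riesz_weight gamma alpha n k)%:C * expi (dot k x)) *
  (f y * expi (- dot k y)).
have iu k : cintegrable (u k) by apply: cintegrableZ; exact: cintegrableM_expi.
rewrite (eq_fsbigr (fun k => c * integral_torus (u k))); last first.
  move=> k _; rewrite /u integral_torusZ; last exact: cintegrableM_expi.
  by rewrite /fourier_coef -/c; ring.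
rewrite fsbig_finite/=; last exact: finite_frequencies.
rewrite -mulr_sumr -(cintegrable_sum _ iu).2; congr (_ * _).
rewrite (@integral_torus_ext _ (fun y => f y * (tensor_kernel gamma alpha n x y)%:C)).
  rewrite /integral_torus; congr (_ +i* _); apply: eq_Rintegral => y _;
    by case: (f y) => a b /=; rewrite mulr0 ?subr0 ?add0r.
move=> y; rewrite -sum_frequencies_tensor fsbig_finite/=; last exact: finite_frequencies.
rewrite mulr_sumr; apply: eq_bigr => k _; rewrite /u expiD; ring.
Qed.

End complex_integrals.

(** * Almost everywhere convergence *)

Lemma cvg_complex (R : realType) (I : Type) (F : set_system I) {FF : Filter F}
    (a b : I -> R) (l : R[i]) :
  a n @[n --> F] --> complex.Re l -> b n @[n --> F] --> complex.Im l ->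
  ((a n +i* b n)%C : R[i]^o) @[n --> F] --> (l : R[i]^o).
Proof.
move=> al bl; apply/(@cvgrPdist_le _ R[i]^o) => e e0.
have eE : e = (complex.Re e)%:C%C.
  by move: e0; case: e => p q; rewrite ltcE/= => /andP[/eqP -> _].
have {e0} e0 : 0 < complex.Re e by move: e0; rewrite ltcE => /andP[].
have e20 : 0 < complex.Re e / 2 by rewrite divr_gt0.
move/cvgrPdist_le : al => /(_ _ e20) al; move/cvgrPdist_le : bl => /(_ _ e20) bl.
apply: filterS2 al bl => n an bn.
rewrite eE; case: l an bn => p q /= an bn.
have -> : `|((p +i* q)%C - (a n +i* b n)%C : R[i])| =
    (Normc.normc ((p - a n) +i* (q - b n))%C)%:C%C by [].
rewrite lecR.
have -> : ((p - a n) +i* (q - b n))%C = ((p - a n) +i* 0)%C + (0 +i* (q - b n))%C.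
  by rewrite /GRing.add/= addr0 add0r.
apply: le_trans (le_normcD _ _) _.
rewrite [leRHS]splitr; apply: lerD.
  by rewrite /= expr0n addr0 sqrtr_sqr.
by rewrite /= expr0n add0r sqrtr_sqr.
Qed.

Theorem corollary14p4 (R : realType) (gamma : R) (hgamma : 1 <= gamma)
    (d : nat) (hd : (1 <= d)%N) (tau : R) (htau : 1 <= tau)
    (alpha : R) (halpha : 0 < alpha)
    (f : d.-tuple R -> R[i]) (hf : L1_torus f) :
  {ae lebesgue_tuple R d, forall x, torus x ->
    (riesz_mean gamma alpha n f x : R[i]^o) @[n --> cone_to_infty tau]
      --> (f x : R[i]^o)}.
Proof.
have fi := L1_torus_cintegrable hf; have [iRe iIm] := fi.
have sRe := ae_summable_integrable hgamma halpha htau hd iRe.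
have sIm := ae_summable_integrable hgamma halpha htau hd iIm.
apply: filterS2 sRe sIm => x cRe cIm Tx.
have pf := cone_to_infty_filter d htau.
pose c : R := (2 * pi) ^- d.
have c0 : (2 * pi) ^+ d != 0 :> R by rewrite expf_neq0// mulf_neq0// gt_eqF// pi_gt0.
have {}cRe := cRe Tx; have {}cIm := cIm Tx.
rewrite (_ : (fun n => riesz_mean gamma alpha n f x) = (fun n =>
    (c * conv_mean gamma alpha n (fun y => complex.Re (f y)) x) +i*
    (c * conv_mean gamma alpha n (fun y => complex.Im (f y)) x))%C); last first.
  apply/funext => n; rewrite riesz_mean_conv_mean// -/c.
  by simpc.
apply: cvg_complex.
  rewrite -[X in _ --> X](mulKf c0); apply: cvgM; first exact: cvg_cst.
  exact: cRe.
rewrite -[X in _ --> X](mulKf c0); apply: cvgM; first exact: cvg_cst.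
exact: cIm.
Qed.
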